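(* For any integers $r\ge k\ge 1$, $h\ge 1$, any vector $\vec b=(b_i)_{i\in[k]}$ of positive integers and any $\epsilon>0$, there exist increasing functions $m^{(i)}:\mathbb N^{k-i}\to\mathbb N$ and $\tilde n^{(i)}:\mathbb N^{k-1-i}\to\mathbb N$, $i\in[k-1]$ (so $\tilde n^{(k-1)}$ is a constant), depending only on $r,k,h,\vec b,\epsilon$, such that the following holds for every choice of the finite probability spaces $\Omega=(\Omega_i)_{i\in\mathfrak r}$ and every $k$-bounded $\vec b$-colored $\mathfrak r$-partite graph $G$ on $\Omega$: $$\mathbb E_{\vec n}\,\mathbb E_{\vec\varphi}\big[\mathrm{reg}_{k,h}(G/\vec\varphi)\big]\le\epsilon .$$ Here $\vec n=(n^{(1)},\dots,n^{(k-1)})$ is chosen as follows: $n^{(k-1)}$ is uniform in $\{0,1,\dots,\tilde n^{(k-1)}-1\}$, and then successively for $i=k-2,k-3,\dots,1$, $n^{(i)}$ is uniform in $\{0,1,\dots,\tilde n^{(i)}(n^{(i+1)},\dots,n^{(k-1)})-1\}$; given $\vec n$, $\vec\varphi=(\varphi_i)_{i\in[k-1]}$ has independent components, each $\varphi_i\in\Phi\big(m^{(i)}(n^{(i)},\dots,n^{(k-1)})\big)$ being a random partitionwise map. (For $k=1$ the statement is trivial: $G/\vec\varphi=G$ and $\mathrm{reg}_{1,h}(G)=0$.)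
   Context: Fix an integer $r\ge1$ and a finite index set $\mathfrak r$ with $|\mathfrak r|=r$. For each $i\in\mathfrak r$ let $\Omega_i$ be a nonempty finite probability space (any probability measure on all subsets); write $\Omega=(\Omega_i)_{i\in\mathfrak r}$. For integers $a\le b$, $[a]=\{1,\dots,a\}$ and $[a,b]=\{a,a+1,\dots,b\}$. Colored graphs. A $k$-bounded $(b_i)_{i\in[k]}$-colored ($\mathfrak r$-partite hyper)graph $H$ consists of pairwise disjoint finite vertex sets $V_i(H)$, $i\in\mathfrak r$; for $J\subseteq\mathfrak r$, $V_J(H)$ denotes the set of sets $e\subseteq\bigcup_{j\in J}V_j(H)$ with $|e\cap V_j(H)|=1$ for all $j\in J$ (edges of index $J$); and, for each $I\subseteq\mathfrak r$ with $1\le|I|\le k$, a set $C_I(H)$ of exactly $b_{|I|}$ colors together with a map $V_I(H)\to C_I(H)$, $e\mapsto H(e)$. For $e\in V_I(H)$ and $\emptyset\ne J\subseteq I$ put $e|_J=e\cap\bigcup_{j\in J}V_j(H)$. The frame-color of $e$ is $H(\partial e)=(H(e|_J))_{\emptyset\ne J\subsetneq I}$ and its total color is $H\langle e\rangle=(H(e|_J))_{\emptyset\ne J\subseteq I}$. Let $TC_I(H)=\{H\langle e\rangle:e\in V_I(H)\}$ and $TC(H)=\bigcup_{1\le|I|\le k}TC_I(H)$. A graph is on $\Omega$ if $V_i=\Omega_i$ for all $i$; then $\Omega_I:=V_I$, and ''${\bf e}\in\Omega_I$ random'' means its vertices in $\Omega_i$, $i\in I$, are chosen independently according to the measures of the $\Omega_i$.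 Simplicial complexes. A $k$-bounded simplicial complex is a $k$-bounded graph $S$ in which for each $I$ at most one color of $C_I(S)$ is designated invisible, such that if an edge $e$ has an invisible color then every edge $e^*\supseteq e$ (of size $\le k$) has an invisible color. Other edges/colors are visible. For a $k$-bounded graph $G$ on $\Omega$ and $s\le k$, $\mathcal S_{s,h,G}$ is the set of $s$-bounded simplicial complexes $S$ with $|V_i(S)|=h$ for every $i\in\mathfrak r$, such that for each $I$ with $1\le|I|\le s$ the visible index-$I$ colors of $S$ are injectively identified with index-$I$ colors of $G$. $\mathbb V_I(S)$ is the set of visible edges of index $I$, $\mathbb V_i(S)=\bigcup_{|I|=i}\mathbb V_I(S)$, $\mathbb V(S)=\bigcup_i\mathbb V_i(S)$, $\mathbb V_{(k-1)}(S)=\bigcup_{i\in[k-1]}\mathbb V_i(S)$. For visible $e$, $S\langle e\rangle$ is regarded as a tuple of colors of $G$. Partitionwise maps. For finite sets $W_i$, $i\in\mathfrak r$, a partitionwise map is a map $\varphi$ on $\dot\bigcup_iW_i$ with $\varphi(W_i)\subseteq\Omega_i$; $\Phi(h)$ denotes the set of these when $|W_i|=h$ for all $i$ (for $S\in\mathcal S_{s,h,G}$ one takes $W_i=V_i(S)$, so $\phi(e)\in\Omega_I$ for $e\in V_I(S)$). A random partitionwise map sends every element of each $W_i$ independently to a point of $\Omega_i$ distributed according to its measure. $\varphi(\mathbb D)$ denotes the image of $\varphi$. $\Phi(m_1,\dots,m_{k-1})=\Phi(m_1)\times\dots\times\Phi(m_{k-1})$, a random element having independent random components. Regularization. Let $G$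 be a $k$-bounded graph on $\Omega$, $m\ge0$, $\varphi\in\Phi(m)$ and $1\le s<k$. $G/^s\varphi$ is the $k$-bounded graph on $\Omega$ obtained from $G$ by recoloring each edge ${\bf e}\in\Omega_I$ with $1\le|I|\le s$ by the vector $\big(G({\bf e}\cup{\bf f}) : J\subseteq\mathfrak r\setminus I,\ 0\le|J|\le s+1-|I|,\ {\bf f}\in\Omega_J,\ {\bf f}\subseteq\varphi(\mathbb D)\big)$ (entries in a fixed order; ${\bf f}=\emptyset$ when $J=\emptyset$); edges of size $>s$ keep their colors. $G/\varphi:=G/^{k-1}\varphi$, and for $\vec\varphi=(\varphi_i)_{i\in[k-1]}$, $G/\vec\varphi:=((G/^{k-1}\varphi_{k-1})/^{k-2}\varphi_{k-2})\cdots/^{1}\varphi_1$. Regularity. For $\vec c=(c_J)_{\emptyset\ne J\subseteq I}\in TC_I(G)$, the relative density is $d_G(\vec c)=\mathbb P_{{\bf e}\in\Omega_I}[G({\bf e})=c_I\mid G(\partial{\bf e})=(c_J)_{J\subsetneq I}]$ (defined as $1$ if the conditioning event has probability $0$). A relation $x=\prod_j(a_j\dot\pm b_j)$ means that there are reals $c_j$ with $\max\{0,a_j-b_j\}\le c_j\le\min\{1,a_j+b_j\}$ and $x=\prod_jc_j$. $G$ is $(\epsilon,k,h)$-regular if there is a function $\delta:TC(G)\to[0,\infty)$ (extended by $\delta=1$ on color tuples not in $TC(G)$) such that (i) for every $S\in\mathcal S_{k,h,G}$, with $\phi\in\Phi(h)$ random, $\mathbb P_{\phi}[G(\phi(e))=S(e)\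 \forall e\in\mathbb V(S)]=\prod_{e\in\mathbb V(S)}\big(d_G(S\langle e\rangle)\dot\pm\delta(S\langle e\rangle)\big)$, and (ii) $\mathbb E_{{\bf e}\in\Omega_I}[\delta(G\langle{\bf e}\rangle)]\le\epsilon/|C_I(G)|$ for every $I\subseteq\mathfrak r$ with $1\le|I|\le k$. $\mathrm{reg}_{k,h}(G)$ is the minimum $\epsilon\ge0$ such that $G$ is $(\epsilon,k,h)$-regular. *)

(* Defs.v *)
From HB Require Import structures.
From mathcomp Require Import all_boot all_order all_algebra.
From mathcomp Require Import reals.


Set Implicit Arguments.
Unset Strict Implicit.
Unset Printing Implicit Defensive.

Import Order.TTheory GRing.Theory Num.Theory.
Local Open Scope ring_scope.

(* Index set r = 'I_r.  Vertex sets V i : finType.  An edge (of any     *)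
(* index) is a partial choice of one vertex per part: an edge of index  *)
(* I is an element with support exactly I.                              *)

Definition gedge (r : nat) (V : 'I_r -> finType) : finType :=
  {dffun forall i : 'I_r, option (V i)}.

Section Edges.
Variables (r : nat) (V : 'I_r -> finType).

Definition supp (e : gedge V) : {set 'I_r} := [set i | e i != None].

Definition restrict (e : gedge V) (J : {set 'I_r}) : gedge V :=
  [ffun i => if i \in J then e i else None].

(* e \cup f (used for disjoint supports) *)
Definition eunion (e f : gedge V) : gedge V :=
  [ffun i => if e i is Some x then Some x else f i].

End Edges.

Definition sedge (r h : nat) : finType := gedge (fun _ : 'I_r => 'I_h).

Definition Phi (r : nat) (Om : 'I_r -> finType) (m : nat) : finType :=
  {dffun forall i : 'I_r, {ffun 'I_m -> Om i}}.

Definition phimap r (Om : 'I_r -> finType) h (phi : Phi Om h) (e : sedge r h)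
  : gedge Om := [ffun i => omap (phi i) (e i)].

Section Prob.
Variables (R : realType) (r : nat) (Om : 'I_r -> finType)
          (P : forall i : 'I_r, Om i -> R).

Definition isProbs : Prop :=
  forall i : 'I_r, (forall x, 0 <= @P i x) /\ \sum_(x : Om i) @P i x = 1.

Definition eweight (e : gedge Om) : R :=
  \prod_(i : 'I_r) oapp (@P i) 1 (e i).

Definition pweight (m : nat) (phi : Phi Om m) : R :=
  \prod_(i : 'I_r) \prod_(j : 'I_m) @P i (phi i j).

Definition Ephi (m : nat) (F : Phi Om m -> R) : R :=
  \sum_(phi : Phi Om m) pweight phi * F phi.

End Prob.

Record cgraph (r : nat) (Om : 'I_r -> finType) := CGraph {
  Col : finType;
  Cset : {set 'I_r} -> {set Col};
  col : gedge Om -> Col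
}.
Arguments CGraph {r Om}.

Definition colored_graph r (Om : 'I_r -> finType) (k : nat) (b : nat -> nat)
  (G : cgraph Om) : Prop :=
  forall I : {set 'I_r}, (0 < #|I| <= k)%N ->
    #|Cset G I| = b #|I| /\
    (forall e : gedge Om, supp e = I -> col G e \in Cset G I).

Section Regularize.
Variables (r : nat) (Om : 'I_r -> finType) (m : nat) (phi : Phi Om m).

Definition in_img (f : gedge Om) : bool :=
  [forall i, if f i is Some x then [exists j, phi i j == x] else true].

Definition admissible (s : nat) (I : {set 'I_r}) (f : gedge Om) : bool :=
  [disjoint supp f & I] && (#|I| + #|supp f| <= s.+1)%N && in_img f.

Variables (G : cgraph Om) (s : nat).

Definition vecCol : finType := {ffun gedge Om -> option (Col G)}.

Definition recol_vec (e : gedge Om) : vecCol :=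
  [ffun f => if admissible s (supp e) f then Some (col G (eunion e f))
             else None].

Definition vecCset (I : {set 'I_r}) : {set vecCol} :=
  [set g : vecCol | [forall f, if admissible s I f then
      (if g f is Some c then c \in Cset G (I :|: supp f) else false)
      else g f == None]].

Definition regCol : finType := (Col G + vecCol)%type.

Definition regularize : cgraph Om :=
  @CGraph r Om regCol
    (fun I => if (#|I| <= s)%N then [set inr g | g in vecCset I]
              else [set inl c | c in Cset G I])
    (fun e => if (#|supp e| <= s)%N then inr (recol_vec e) else inl (col G e)).

End Regularize.

Section Regularity.
Variables (R : realType) (r : nat) (Om : 'I_r -> finType)
          (P : forall i : 'I_r, Om i -> R) (k h : nat).

Section Graph.
Variable H : cgraph Om.

Definition tcolT : finType := {ffun {set 'I_r} -> option (Col H)}.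

Definition tcol (e : gedge Om) : tcolT :=
  [ffun J => if (J != set0) && (J \subset supp e)
             then Some (col H (restrict e J)) else None].

Definition inTC (t : tcolT) : bool :=
  [exists e : gedge Om, (0 < #|supp e| <= k)%N && (tcol e == t)].

Definition frame_match (e : gedge Om) (t : tcolT) : bool :=
  [forall J : {set 'I_r}, ((J != set0) && (J \proper supp e)) ==>
                          (tcol e J == t J)].

Definition reldens (I : {set 'I_r}) (t : tcolT) : R :=
  let den := \sum_(e : gedge Om | (supp e == I) && frame_match e t)
               eweight P e in
  if den == 0 then 1
  else (\sum_(e : gedge Om | (supp e == I) && (tcol e == t)) eweight P e)
        / den.

(* k-bounded simplicial complexes in S_{k,h,H}: None = invisible color, *)
(* visible colors are (identified with) index-I colors of H.            *)
Definition is_scomplex (S : sedge r h -> option (Col H)) : Prop :=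
  (forall e : sedge r h, (0 < #|supp e| <= k)%N ->
     if S e is Some c then c \in Cset H (supp e) else true) /\
  (forall e e' : sedge r h, (0 < #|supp e|)%N -> (#|supp e'| <= k)%N ->
     restrict e' (supp e) = e -> S e = None -> S e' = None).

Definition visible (S : sedge r h -> option (Col H)) (e : sedge r h) : bool :=
  (0 < #|supp e| <= k)%N && (S e != None).

Definition stcol (S : sedge r h -> option (Col H)) (e : sedge r h) : tcolT :=
  [ffun J => if (J != set0) && (J \subset supp e) then S (restrict e J)
             else None].

Definition approx_prod (vis : pred (sedge r h)) (x : R)
  (a b : sedge r h -> R) : Prop :=
  exists c : sedge r h -> R,
    (forall e, vis e -> Num.max 0 (a e - b e) <= c e <= Num.min 1 (a e + b e))
    /\ x = \prod_(e : sedge r h | vis e) c e.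

Definition prob_embed (S : sedge r h -> option (Col H)) : R :=
  Ephi P (fun phi : Phi Om h =>
    if [forall e : sedge r h, visible S e ==>
          (Some (col H (phimap phi e)) == S e)] then 1 else 0).

Definition regular (eps : R) : Prop :=
  exists delta : tcolT -> R,
    (forall t, 0 <= delta t) /\
    (forall t, ~~ inTC t -> delta t = 1) /\
    (forall S : sedge r h -> option (Col H), is_scomplex S ->
       approx_prod (visible S) (prob_embed S)
         (fun e => reldens (supp e) (stcol S e))
         (fun e => delta (stcol S e))) /\
    (forall I : {set 'I_r}, (0 < #|I| <= k)%N ->
       \sum_(e : gedge Om | supp e == I) eweight P e * delta (tcol e)
         <= eps / (#|Cset H I|)%:R).

Definition reg : R := inf (fun eps : R => 0 <= eps /\ regular eps).

End Graph.

(* E_phivec[ reg(G / phivec) ] given nvec = [n_1; ...; n_{k-1}]:        *)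
(* phi_i in Phi(m_i(n_i,...,n_{k-1})), and                               *)
(* G/phivec = ((G /^{k-1} phi_{k-1}) /^{k-2} phi_{k-2}) ... /^1 phi_1.   *)
Fixpoint regE (m : nat -> seq nat -> nat) (ns : seq nat) (i : nat)
  (G : cgraph Om) {struct i} : R :=
  match i with
  | 0 => reg G
  | i'.+1 => Ephi P (fun phi : Phi Om (m i (drop i' ns)) =>
               regE m ns i' (regularize phi G i))
  end.

End Regularity.

(* E_nvec[F nvec]: n^{(k-1)} uniform in [0, nt_{k-1}()), then for        *)
(* i = k-2,...,1, n^{(i)} uniform in [0, nt_i(n^{(i+1)},...,n^{(k-1)})).   *)
(* ns is the already chosen suffix [n^{(i+1)}; ...; n^{(k-1)}].           *)
Fixpoint sampleE (R : realType) (nt : nat -> seq nat -> nat) (k : nat)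
  (l : nat) (ns : seq nat) (F : seq nat -> R) {struct l} : R :=
  match l with
  | 0 => F ns
  | l'.+1 =>
      let N := nt (k.-1 - size ns)%N ns in
      (N%:R)^-1 * \sum_(x < N) sampleE nt k l' (nat_of_ord x :: ns) F
  end.

Definition incr_fun (len : nat) (f : seq nat -> nat) : Prop :=
  forall s t : seq nat, size s = len -> size t = len ->
    all2 leq s t -> (f s <= f t)%N.

(* Main.v *)
(* Counting.  Call an edge good if its relative density is not too small and if
   its density barely changes, in mean square, when the frame colours are refined
   by fresh random vertices.  For a complex all of whose total colours are good,
   the edges are removed one at a time, a largest edge first.  The error of one
   removal is an average over many disjoint fresh copies of the vertices outside
   the edge; given these copies the remaining constraints are a function of the
   refined frame colour, so the colour indicator may be replaced by its refined
   density, and Cauchy-Schwarz applies.  The second moment of the copies is the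
   count of a complex doubled along the edge, which only has smaller edges.
   The number of copies needed depends on the densities of the smaller edges.

   Energy.  The mean square deviation at level [j] is a difference of energies of
   the colours of [j]-edges.  The refining points, together with all points
   sampled below level [j - 1], can be regarded as further sample points of level
   [j - 1]: the increment of [m^(j-1)] from [n] to [n + 1] is chosen larger than
   everything sampled at the lower levels when [n^(j-1) = n].  So the expected
   deviation telescopes over [n^(j-1)], and no independence between levels is
   lost. *)

Require Import Defs.
From HB Require Import structures.
From mathcomp Require Import all_boot all_order all_algebra.
From mathcomp Require Import reals ring lra zify.
(* [matrix] also defines [col]. *)
Import Defs.

Set Implicit Arguments.
Unset Strict Implicit.
Unset Printing Implicit Defensive.

Import Order.TTheory GRing.Theory Num.Theory.
Local Open Scope ring_scope.

(** * Conditional expectation and energy on a finite weighted space *)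

(** The obstacle is the order of the quantifiers. Each recolouring multiplies the colours of smaller
    edges, so their densities may be tiny compared with anything known when the number of rounds at
    a higher level is fixed. The deviation allowed for an edge of size [j] may therefore depend only
    on the colour bound belonging to size [j]. In the Cauchy-Schwarz step the lower densities have
    to cancel: the doubled complex contains every lower edge twice, except those inside the removed
    edge, and the missing factors are restored by the mass of its frame class, by which the
    deviation is normalised. Only powers of constants and of the density threshold at size [j]
    remain. The number of fresh copies does depend on the lower densities, but it enlarges the
    increments of the sample sizes, not the number of rounds of a higher level. Total colours that
    are not good need no count: there [delta] is 1, the factor may be any number in [[0, 1]], and
    one such factor absorbs the whole discrepancy. *)

Section WeightedSpace.
Variables (R : realFieldType) (T : finType) (w : T -> R).
Hypothesis w_ge0 : forall x, 0 <= w x.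

(** A class of weight zero gets the value 0, by division by zero; the identities below are weighted
    by [w], so for an equivalence [rho] such classes never contribute. *)
Definition cexp (rho : rel T) (f : T -> R) (x : T) : R :=
  (\sum_(y | rho x y) w y * f y) / (\sum_(y | rho x y) w y).

Lemma cauchy_schwarz (f g : T -> R) :
  (\sum_x w x * (f x * g x)) ^+ 2
    <= (\sum_x w x * f x ^+ 2) * (\sum_x w x * g x ^+ 2).
Proof.
have : 0 <= \sum_x \sum_y w x * w y * (f x * g y - f y * g x) ^+ 2.
  by apply: sumr_ge0 => x _; apply: sumr_ge0 => y _;
     rewrite mulr_ge0 ?sqr_ge0 ?mulr_ge0.
have -> : \sum_x \sum_y w x * w y * (f x * g y - f y * g x) ^+ 2 =
   2 * ((\sum_x w x * f x ^+ 2) * (\sum_x w x * g x ^+ 2)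
        - (\sum_x w x * (f x * g x)) ^+ 2).
  set A := \sum_x w x * f x ^+ 2; set B := \sum_x w x * g x ^+ 2.
  set D := \sum_x w x * (f x * g x).
  have -> : 2 * (A * B - D ^+ 2) = A * B + B * A - (D * D + D * D) by ring.
  rewrite /A /B /D !big_distrlr -!big_split -sumrB /=; apply: eq_bigr => x _.
  rewrite -!big_split -sumrB /=; apply: eq_bigr => y _; ring.
by rewrite pmulr_rge0 ?subr_ge0 // ltr0n.
Qed.

Lemma cexp_ge0 (rho : rel T) (f : T -> R) x : (forall y, 0 <= f y) -> 0 <= cexp rho f x.
Proof.
move=> f0; rewrite /cexp divr_ge0 ?sumr_ge0 // => y _; exact: mulr_ge0.
Qed.

Lemma cexp_le1 (rho : rel T) (f : T -> R) x : (forall y, f y <= 1) -> cexp rho f x <= 1.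
Proof.
move=> f1; rewrite /cexp; set D := \sum_(y | rho x y) w y.
have [->|D0] := eqVneq D 0; first by rewrite invr0 mulr0.
have Dp : 0 < D by rewrite lt_def D0 /D sumr_ge0.
rewrite ler_pdivrMr // mul1r; apply: ler_sum => y _.
by rewrite -[leRHS]mulr1 ler_wpM2l.
Qed.

Lemma eq_cexp (rho rho' : rel T) (f f' : T -> R) x :
  (forall y, 0 < w y -> rho x y = rho' x y) ->
  (forall y, 0 < w y -> rho x y -> f y = f' y) ->
  cexp rho f x = cexp rho' f' x.
Proof.
move=> e ef; rewrite /cexp; congr (_ / _).
  rewrite [LHS]big_mkcond [RHS]big_mkcond; apply: eq_bigr => y _.
  have := w_ge0 y; rewrite le_eqVlt => /orP[/eqP <-|wy].
    by rewrite !mul0r !if_same.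
  by rewrite -e //; case: ifP => // /(ef _ wy) ->.
rewrite [LHS]big_mkcond [RHS]big_mkcond; apply: eq_bigr => y _.
have := w_ge0 y; rewrite le_eqVlt => /orP[/eqP <-|wy]; first by rewrite !if_same.
by rewrite -e.
Qed.

Section Equivalence.
Variable rho : rel T.
Hypothesis rhoE : equivalence_rel rho.

Lemma rel_refl x : rho x x. Proof. by case: (rhoE x x x). Qed.

Lemma rel_eqr x y : rho x y -> rho x =1 rho y.
Proof. by move=> rxy z; have [_ ->] := rhoE x y z. Qed.

Lemma rel_symP x y : rho x y = rho y x.
Proof.
apply/idP/idP => h; have := rel_eqr h.
  by move=> /(_ x); rewrite rel_refl.
by move=> /(_ y); rewrite rel_refl.
Qed.

Lemma cexp_const f x y : rho x y -> cexp rho f x = cexp rho f y.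
Proof.
by move=> /rel_eqr e; rewrite /cexp; congr (_ / _); apply: eq_bigl => z; rewrite e.
Qed.

(** Self-adjointness of the conditional expectation: after exchanging the two sums the class weight
    cancels. Invariance of [g] is asked only between points of positive weight because the edge laws
    used later vanish off one index set. *)
Lemma cexpM (f g : T -> R) :
  (forall x y, 0 < w x -> 0 < w y -> rho x y -> g x = g y) ->
  \sum_x w x * (cexp rho f x * g x) = \sum_x w x * (f x * g x).
Proof.
move=> ginv; rewrite /cexp.
transitivity (\sum_x \sum_y (if rho x y then
   w x * (w y * f y) * g y / (\sum_(z | rho y z) w z) else 0)).
  apply: eq_bigr => x _; rewrite -mulrA mulr_suml mulr_sumr big_mkcond.
  apply: eq_bigr => y _; case: ifP => // rxy.
  rewrite -(eq_bigl _ _ (rel_eqr rxy)).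
  have := w_ge0 x; rewrite le_eqVlt => /orP[/eqP <-|wx]; first by rewrite !mul0r.
  have := w_ge0 y; rewrite le_eqVlt => /orP[/eqP <-|wy].
    by rewrite !(mul0r, mulr0).
  by rewrite (ginv x y) //; ring.
rewrite exchange_big; apply: eq_bigr => y _ /=.
rewrite -big_mkcond /=.
under eq_bigl do rewrite rel_symP.
under eq_bigr do rewrite -!mulrA.
rewrite -mulr_suml; set D := \sum_(z | _) _.
(* A class of weight zero forces [w y = 0], since [y] belongs to it. *)
have [D0|D0] := eqVneq D 0; last by field.
suff -> : w y = 0 by rewrite !(mul0r, mulr0).
by move/eqP: D0; rewrite psumr_eq0 // => /allP /(_ y (mem_index_enum _));
   rewrite rel_refl => /eqP.
Qed.

Lemma sum_cexp f : \sum_x w x * cexp rho f x = \sum_x w x * f x.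
Proof.
have := @cexpM f (fun=> 1) (fun _ _ _ _ _ => erefl).
by under eq_bigr do rewrite mulr1; under [RHS]eq_bigr do rewrite mulr1.
Qed.

Lemma cexp_sqr f :
  \sum_x w x * cexp rho f x ^+ 2 = \sum_x w x * (f x * cexp rho f x).
Proof.
rewrite -cexpM //; last by move=> x y _ _; exact: cexp_const.
Qed.

End Equivalence.

(** The coarser expectation is a projection of the finer one: by [cexpM] the mixed term equals the
    coarser square. *)
Lemma cexp_pythagoras (rho rho' : rel T) (f : T -> R) :
  equivalence_rel rho -> equivalence_rel rho' ->
  (forall x y, 0 < w x -> 0 < w y -> rho x y -> rho' x y) ->
  \sum_x w x * (cexp rho f x - cexp rho' f x) ^+ 2 =
  \sum_x w x * cexp rho f x ^+ 2 - \sum_x w x * cexp rho' f x ^+ 2.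
Proof.
move=> E E' sub.
have h : \sum_x w x * (cexp rho f x * cexp rho' f x) =
         \sum_x w x * cexp rho' f x ^+ 2.
  rewrite cexpM ?cexp_sqr // => x y wx wy /(sub _ _ wx wy); exact: cexp_const.
set S := \sum_x w x * cexp rho f x ^+ 2; set X := \sum_x _ in h.
set S' := \sum_x _ in h *.
have -> : S - S' = S - (X + X) + S' by rewrite h; ring.
rewrite /S /X /S' -big_split -sumrB -big_split /=; apply: eq_bigr => x _; ring.
Qed.

Section Energy.
Variables (C : finType) (q : T -> C).

Definition energy (rho : rel T) : R :=
  \sum_(c : C) \sum_x w x * cexp rho (fun y => (q y == c)%:R) x ^+ 2.

(** Each point contributes only for its own colour, so the energy is a mean density. Hence a bound
    by the total weight, whatever the number of colours. *)
Lemma energy_diagE rho : equivalence_rel rho ->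
  energy rho = \sum_x w x * cexp rho (fun y => (q y == q x)%:R) x.
Proof.
move=> E; rewrite /energy; under eq_bigr do rewrite cexp_sqr //.
rewrite exchange_big; apply: eq_bigr => x _ /=.
rewrite (bigD1 (q x)) //= eqxx mul1r big1 ?addr0 // => c nc.
by rewrite eq_sym (negPf nc) mul0r mulr0.
Qed.

Lemma energy_diff (rho rho' : rel T) :
  equivalence_rel rho -> equivalence_rel rho' ->
  (forall x y, 0 < w x -> 0 < w y -> rho x y -> rho' x y) ->
  \sum_(c : C) \sum_x w x * (cexp rho (fun y => (q y == c)%:R) x
                             - cexp rho' (fun y => (q y == c)%:R) x) ^+ 2 =
  energy rho - energy rho'.
Proof.
move=> E E' sub; rewrite /energy -sumrB; apply: eq_bigr => c _.
exact: cexp_pythagoras.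
Qed.

Lemma energy_mono (rho rho' : rel T) :
  equivalence_rel rho -> equivalence_rel rho' ->
  (forall x y, 0 < w x -> 0 < w y -> rho x y -> rho' x y) ->
  energy rho' <= energy rho.
Proof.
move=> E E' sub; rewrite -subr_ge0 -energy_diff //.
by apply: sumr_ge0 => c _; apply: sumr_ge0 => x _; rewrite mulr_ge0 ?sqr_ge0.
Qed.

Lemma energy_ge0 rho : 0 <= energy rho.
Proof.
by apply: sumr_ge0 => c _; apply: sumr_ge0 => x _; rewrite mulr_ge0 ?sqr_ge0.
Qed.

Lemma energy_le rho : equivalence_rel rho -> energy rho <= \sum_x w x.
Proof.
move=> E; rewrite energy_diagE //; apply: ler_sum => x _.
by rewrite -[leRHS]mulr1 ler_wpM2l // cexp_le1 // => y; rewrite lern1 leq_b1.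
Qed.

(** In one class the points of colour [c] are either all of low density or none is, and in the first
    case they carry a fraction below [t] of the class. Summing over the colours costs the factor
    [#|A|]. *)
Lemma low_density_mass (rho : rel T) (A : {set C}) (t : R) :
  equivalence_rel rho -> 0 <= t -> \sum_x w x = 1 ->
  (forall x, 0 < w x -> q x \in A) ->
  \sum_x w x * (cexp rho (fun y => (q y == q x)%:R) x < t)%R%:R <= t * #|A|%:R.
Proof.
move=> E t0 w1 qA.
pose bad c y := ((q y == c) && (cexp rho (fun z => (q z == c)%:R) y < t)%R)%:R : R.
have -> : \sum_x w x * (cexp rho (fun y => (q y == q x)%:R) x < t)%R%:R =
   \sum_(c in A) \sum_x w x * bad c x.
  rewrite exchange_big; apply: eq_bigr => x _ /=.
  have := w_ge0 x; rewrite le_eqVlt => /orP[/eqP <-|wx].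
    by rewrite mul0r big1 // => c _; rewrite mul0r.
  rewrite (bigD1 (q x)) ?qA //= /bad eqxx big1 ?addr0 // => c /andP[_ nc].
  by rewrite eq_sym (negPf nc) mulr0.
rewrite mulr_natr -sumr_const; apply: ler_sum => c _.
rewrite -(sum_cexp E) -[leRHS]mul1r -w1 mulr_suml; apply: ler_sum => x _.
apply: ler_wpM2l => //.
have [/existsP[y /and3P[rxy qy dy]]|nex] := boolP [exists y, [&& rho x y, q y == c
   & cexp rho (fun z => (q z == c)%:R) y < t]].
  apply: le_trans (ltW dy); rewrite -(cexp_const E _ rxy).
  rewrite /cexp ler_wpM2r ?invr_ge0 ?sumr_ge0 //; apply: ler_sum => z _.
  by rewrite ler_wpM2l // /bad ler_nat; case: eqP => //=; rewrite leq_b1.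
rewrite /cexp big1 ?mul0r // => y rxy.
move: nex; rewrite negb_exists => /forallP /(_ y).
by rewrite rxy /= /bad => /negPf ->; rewrite mulr0.
Qed.

End Energy.

(** Only the partition by colour matters. The colour types may differ, so a recoloured graph can be
    compared with an earlier one on edges whose colour classes did not change. *)
Lemma eq_energy (C C' : finType) (q : T -> C) (q' : T -> C') (rho : rel T) :
  equivalence_rel rho ->
  (forall x y, 0 < w x -> 0 < w y -> (q x == q y) = (q' x == q' y)) ->
  energy q rho = energy q' rho.
Proof.
move=> E e; rewrite !energy_diagE //; apply: eq_bigr => x _.
have := w_ge0 x; rewrite le_eqVlt => /orP[/eqP <-|wx]; first by rewrite !mul0r.
by congr (_ * _); apply: eq_cexp => // y wy _; rewrite e.
Qed.

End WeightedSpace.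

(** * Random partitionwise maps *)

Lemma dffun_distr (R : comPzSemiRingType) (I : finType) (T : I -> finType)
  (C : forall i, pred (T i)) (F : forall i, T i -> R) :
  \sum_(f : {dffun forall i, T i} | [forall i, C i (f i)]) \prod_i F i (f i) =
  \prod_i \sum_(x | C i x) F i x.
Proof.
pose P_ i : {ffun T i -> R} := [ffun x => if C i x then F i x else 0].
transitivity (\sum_(t : fprod T) \prod_(i : I) P_ i (t i)); last first.
  rewrite (@big_fprod _ 0 1 *%R +%R) /=.
  rewrite -(@bigA_distr_big_dep _ _ _ *%R +%R _ _ (fun i => tagged_with T i)
     (fun i => untag 0 (P_ i))).
  apply: eq_bigr => i _; rewrite [RHS]big_mkcond.
  transitivity (\sum_x P_ i x); last by apply: eq_bigr => x _; rewrite ffunE.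
  exact/esym/(@big_tag _ 0 +%R _ T (fun i x => P_ i x) i).
rewrite (reindex (@dffun_of_fprod I T)) /=; last exact/onW_bij/dffun_of_fprod_bij.
rewrite big_mkcond; apply: eq_bigr => t _.
case: ifP => [/forallP h|/negbT].
  by apply: eq_bigr => i _; have := h i; rewrite !ffunE => ->.
rewrite negb_forall => /existsP[i]; rewrite ffunE => nc.
by rewrite (bigD1 i) //= ffunE (negPf nc) mul0r.
Qed.

(** The coordinates outside the image of [s] are free, and each sums to 1. *)
Lemma sum_ffun_fixed (R : comPzSemiRingType) (A B X : finType) (p : X -> R)
  (s : A -> B) (v : A -> X) :
  \sum_x p x = 1 -> injective s ->
  \sum_(z : {ffun B -> X} | [forall a, z (s a) == v a]) \prod_b p (z b) =
  \prod_a p (v a).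
Proof.
move=> p1 sI; pose Q b x := [forall a, (s a == b) ==> (x == v a)].
rewrite (eq_bigl (mem (family Q))); last first.
  move=> z; apply/forallP/familyP => [h b|h a].
    by apply/forallP => a; apply/implyP => /eqP <-.
  by have /forallP /(_ a) := h (s a); rewrite eqxx.
rewrite -(@bigA_distr_big_dep _ _ _ *%R +%R _ _ Q (fun _ => p)) /=.
rewrite (bigID [pred b | b \in codom s]) /= [X in _ * X]big1 ?mulr1; last first.
  move=> b nb; rewrite -[RHS]p1; apply: eq_bigl => x; apply/forallP => a.
  by apply/implyP => /eqP e; move: nb; rewrite -e codom_f.
rewrite -big_uniq /=; last by rewrite map_inj_uniq // enum_uniq.
rewrite big_image /=.
apply: eq_bigr => a _; rewrite (big_pred1 (v a)) // => x.
apply/forallP/eqP => [/(_ a)|-> a']; first by rewrite eqxx => /eqP.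
by apply/implyP => /eqP /sI ->.
Qed.

Section Sampling.
Variables (R : realType) (r : nat) (Om : 'I_r -> finType)
          (P : forall i : 'I_r, Om i -> R).
Hypothesis Pprob : isProbs P.

Let P_ge0 i x : 0 <= P (i := i) x. Proof. exact: (Pprob i).1. Qed.
Let P_sum1 i : \sum_x P (i := i) x = 1. Proof. exact: (Pprob i).2. Qed.

Lemma pweight_ge0 m (phi : Phi Om m) : 0 <= pweight P phi.
Proof. by apply: prodr_ge0 => i _; apply: prodr_ge0 => j _; apply: P_ge0. Qed.

Lemma eweight_ge0 (e : gedge Om) : 0 <= eweight P e.
Proof. by apply: prodr_ge0 => i _; case: (e i) => [x|] /=; rewrite ?P_ge0. Qed.

(** Extension by zero puts the laws of all index sets on the one type [gedge Om], where the
    weighted-space lemmas apply. *)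
Definition iweight (I : {set 'I_r}) (e : gedge Om) : R :=
  if supp e == I then eweight P e else 0.

Lemma iweight_ge0 I e : 0 <= iweight I e.
Proof. by rewrite /iweight; case: ifP => // _; exact: eweight_ge0. Qed.

Lemma iweight_gt0 I e : 0 < iweight I e -> supp e = I.
Proof. by rewrite /iweight; case: eqP => //; rewrite ltxx. Qed.

Lemma sum_iweight I (F : gedge Om -> R) :
  \sum_(e | supp e == I) eweight P e * F e = \sum_e iweight I e * F e.
Proof.
by rewrite big_mkcond; apply: eq_bigr => e _; rewrite /iweight; case: ifP; rewrite ?mul0r.
Qed.

(* Both the joint law of finitely many sample points and that of a random edge
   are obtained by prescribing the values of [phi] at an injective family of
   places. *)
Lemma sum_pweight_fixed m (A : 'I_r -> finType) (s : forall i, A i -> 'I_m)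
  (v : forall i, A i -> Om i) :
  (forall i, injective (s i)) ->
  \sum_(phi : Phi Om m | [forall i, [forall a, phi i (s i a) == v i a]])
     pweight P phi = \prod_i \prod_a P (v i a).
Proof.
move=> sI; rewrite (@dffun_distr R _ (fun i => {ffun 'I_m -> Om i})
   (fun i z => [forall a, z (s i a) == v i a])
   (fun i z => \prod_j P (z j))).
by apply: eq_bigr => i _; rewrite sum_ffun_fixed.
Qed.

Lemma sum_pweight m : \sum_(phi : Phi Om m) pweight P phi = 1.
Proof.
pose s (i : 'I_r) (a : void) : 'I_m := match a with end.
pose v (i : 'I_r) (a : void) : Om i := match a with end.
have sI i : injective (s i) by move=> x; case: x.
have := sum_pweight_fixed (A := fun=> void) v sI.
rewrite [RHS]big1 => [<-|i _]; last by rewrite big1 // => -[].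
by apply: eq_bigl => phi; apply/esym/forallP => i; apply/forallP; case.
Qed.

Definition reindex_phi a b (s : 'I_r -> 'I_a -> 'I_b) (phi : Phi Om b) : Phi Om a :=
  [ffun i => [ffun j => phi i (s i j)]].

Lemma Ephi_reindex a b (s : 'I_r -> 'I_a -> 'I_b) (F : Phi Om a -> R) :
  (forall i, injective (s i)) ->
  Ephi P (fun phi => F (reindex_phi s phi)) = Ephi P F.
Proof.
move=> sI; rewrite /Ephi (partition_big (reindex_phi s) predT) //=.
apply: eq_bigr => psi _.
rewrite (eq_bigr (fun phi => pweight P phi * F psi)); last by move=> ? /eqP ->.
rewrite -mulr_suml; congr (_ * _).
rewrite /pweight -(sum_pweight_fixed (s := s) (fun i j => psi i j)) //.
apply: eq_bigl => phi; apply/eqP/forallP => [<- i|h].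
  by apply/forallP => j; rewrite !ffunE.
by apply/ffunP => i; apply/ffunP => j; rewrite !ffunE; apply/eqP/(forallP (h i)).
Qed.

Lemma supp_phimap m (phi : Phi Om m) (e : sedge r m) : supp (phimap phi e) = supp e.
Proof. by apply/setP => i; rewrite !inE ffunE; case: (e i). Qed.

Lemma Ephi_edge m (e : sedge r m) (F : gedge Om -> R) :
  Ephi P (fun phi : Phi Om m => F (phimap phi e)) =
  \sum_x iweight (supp e) x * F x.
Proof.
rewrite /Ephi (partition_big (fun phi : Phi Om m => phimap phi e) predT) //=.
apply: eq_bigr => x _.
rewrite (eq_bigr (fun phi => pweight P phi * F x)); last by move=> ? /eqP ->.
rewrite -mulr_suml; congr (_ * _); rewrite /iweight.
case: eqP => [sx|nsx]; last first.
  by rewrite big_pred0 // => phi; apply/eqP => h; case: nsx; rewrite -h supp_phimap.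
(* A place is stored together with its prescribed value, so [A i] has one element where [e] has a
   vertex and is empty elsewhere. Obtaining [B] from an existential keeps it opaque. *)
have [B BE] : exists B : forall i, pred ('I_m * Om i),
    forall i u, B i u = (e i == Some u.1) && (x i == Some u.2).
  by exists (fun i u => (e i == Some u.1) && (x i == Some u.2)).
pose A i : finType := {u : 'I_m * Om i | B i u}.
have sI i : injective (fun a : A i => (val a).1).
  move=> [[a1 a2] /= ha] [[b1 b2] /= hb] /= eab; apply/val_inj => /=.
  move: (ha) (hb); rewrite !BE => /andP[_ /eqP xa] /andP[_ /eqP].
  by rewrite xa => -[->]; rewrite eab.
have se i : (e i != None) = (x i != None) by move/setP: sx => /(_ i); rewrite !inE.
have step i : oapp (@P i) 1 (x i) = \prod_(a : A i) P (val a).2.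
  have := se i; case ei: (e i) => [j|]; case xi: (x i) => [y|] //= _; last first.
    by rewrite big1 // => -[[a1 a2] ha]; exfalso; move: ha; rewrite BE ei.
  have h : B i (j, y) by rewrite BE ei xi !eqxx.
  rewrite (big_pred1 (exist _ (j, y) h)) // => -[[a1 a2] /= ha].
  apply/esym/eqP/val_inj => /=; move: (ha); rewrite BE ei xi.
  by move=> /andP[/eqP[->] /eqP[->]].
rewrite /eweight (eq_bigr _ (fun i _ => step i)).
rewrite -(sum_pweight_fixed (fun i (a : A i) => (val a).2) sI).
apply: eq_bigl => phi; apply/eqP/forallP => [h i|h].
  apply/forallP => -[[a1 a2] /= ha]; move: (ha); rewrite BE => /andP[/eqP ei /eqP xi].
  by move: xi; rewrite -h ffunE ei => -[->].
apply/ffunP => i; rewrite ffunE.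
have := se i; case ei: (e i) => [j|]; case xi: (x i) => [y|] //= _.
have g : B i (j, y) by rewrite BE ei xi !eqxx.
by have /forallP /(_ (exist _ (j, y) g)) /= /eqP -> := h i.
Qed.

Lemma sum_iweight1 m (e : sedge r m) : \sum_x iweight (supp e) x = 1.
Proof.
have := Ephi_edge e (fun=> 1); under [RHS]eq_bigr do rewrite mulr1.
by move=> <-; rewrite /Ephi; under eq_bigr do rewrite mulr1; exact: sum_pweight.
Qed.

Lemma iweight_sum1 I : \sum_x iweight I x = 1.
Proof.
pose e : sedge r 1 := [ffun i => if i \in I then Some ord0 else None].
have <- : supp e = I by apply/setP => i; rewrite inE ffunE; case: (i \in I).
exact: sum_iweight1.
Qed.

Definition cat_phi m n (phi : Phi Om m) (psi : Phi Om n) : Phi Om (m + n) :=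
  [ffun i => [ffun j => match split j with inl a => phi i a | inr b => psi i b end]].

Lemma pweight_cat m n (phi : Phi Om m) (psi : Phi Om n) :
  pweight P (cat_phi phi psi) = pweight P phi * pweight P psi.
Proof.
rewrite /pweight -big_split /=; apply: eq_bigr => i _.
rewrite big_split_ord /=; congr (_ * _); apply: eq_bigr => j _.
  by rewrite !ffunE; have := unsplitK (inl _ j) => /= ->.
by rewrite !ffunE; have := unsplitK (inr _ j) => /= ->.
Qed.

Lemma Ephi_cat m n (F : Phi Om (m + n) -> R) :
  Ephi P F = Ephi P (fun phi : Phi Om m =>
               Ephi P (fun psi : Phi Om n => F (cat_phi phi psi))).
Proof.
rewrite /Ephi; under [RHS]eq_bigr do rewrite mulr_sumr.
rewrite pair_big /= (reindex (fun u => cat_phi u.1 u.2)) /=; last first.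
  exists (fun Z : Phi Om (m + n) =>
     ((reindex_phi (fun _ => lshift n) Z, reindex_phi (fun _ => @rshift m n) Z))).
    move=> [phi psi] _ /=; congr (_, _); apply/ffunP => i; apply/ffunP => j.
      by rewrite !ffunE; have := unsplitK (inl _ j) => /= ->.
    by rewrite !ffunE; have := unsplitK (inr _ j) => /= ->.
  move=> Z _ /=; apply/ffunP => i; apply/ffunP => j; rewrite !ffunE.
  by case: split_ordP => a ->; rewrite !ffunE.
by apply: eq_bigr => -[phi psi] _ /=; rewrite pweight_cat mulrA.
Qed.

Lemma eq_Ephi m (F F' : Phi Om m -> R) : F =1 F' -> Ephi P F = Ephi P F'.
Proof. by move=> e; apply: eq_bigr => phi _; rewrite e. Qed.

Lemma le_Ephi m (F F' : Phi Om m -> R) :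
  (forall phi, F phi <= F' phi) -> Ephi P F <= Ephi P F'.
Proof. by move=> e; apply: ler_sum => phi _; rewrite ler_wpM2l ?pweight_ge0. Qed.

Lemma EphiD m (F F' : Phi Om m -> R) :
  Ephi P (fun phi => F phi + F' phi) = Ephi P F + Ephi P F'.
Proof. by rewrite /Ephi -big_split; apply: eq_bigr => phi _; rewrite mulrDr. Qed.

Lemma EphiZ m c (F : Phi Om m -> R) :
  Ephi P (fun phi => c * F phi) = c * Ephi P F.
Proof. by rewrite /Ephi mulr_sumr; apply: eq_bigr => phi _; rewrite mulrCA. Qed.

Lemma Ephi_sum m (I : Type) (s : seq I) (p : pred I) (F : I -> Phi Om m -> R) :
  Ephi P (fun phi => \sum_(i <- s | p i) F i phi) = \sum_(i <- s | p i) Ephi P (F i).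
Proof.
rewrite /Ephi exchange_big; apply: eq_bigr => phi _; by rewrite mulr_sumr.
Qed.

Lemma Ephi_cst m c : Ephi P (fun _ : Phi Om m => c) = c.
Proof. by rewrite /Ephi -mulr_suml sum_pweight mul1r. Qed.

Lemma EphiB m (F F' : Phi Om m -> R) :
  Ephi P (fun phi => F phi - F' phi) = Ephi P F - Ephi P F'.
Proof.
rewrite -mulN1r -EphiZ -EphiD; apply: eq_Ephi => phi; by rewrite mulN1r.
Qed.

Lemma Ephi_ge0 m (F : Phi Om m -> R) : (forall phi, 0 <= F phi) -> 0 <= Ephi P F.
Proof. by move=> h; rewrite -(Ephi_cst m 0); apply: le_Ephi. Qed.

End Sampling.

(** * Recolouring and refinement of frame colours *)

Section EdgeOperations.
Variables (r : nat) (V : 'I_r -> finType).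
Implicit Types (e f : gedge V) (I J K : {set 'I_r}).

Definition void_edge : gedge V := [ffun i => None].

Lemma supp_void : supp void_edge = set0.
Proof. by apply/setP => i; rewrite !inE ffunE. Qed.

Lemma supp_restrict e J : supp (restrict e J) = J :&: supp e.
Proof. by apply/setP => i; rewrite !inE ffunE; case: (i \in J). Qed.

Lemma supp_eunion e f : supp (eunion e f) = supp e :|: supp f.
Proof. by apply/setP => i; rewrite !inE ffunE; case: (e i). Qed.

Lemma eunion_void e : eunion e void_edge = e.
Proof. by apply/ffunP => i; rewrite !ffunE; case: (e i). Qed.

Lemma eunionA e f g : eunion (eunion e f) g = eunion e (eunion f g).
Proof. by apply/ffunP => i; rewrite !ffunE; case: (e i). Qed.

Lemma restrict_restrict e J K : restrict (restrict e J) K = restrict e (J :&: K).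
Proof. by apply/ffunP => i; rewrite !ffunE inE; do 2!case: (i \in _). Qed.

Lemma restrict_supp e : restrict e (supp e) = e.
Proof. by apply/ffunP => i; rewrite ffunE inE; case: (e i). Qed.

Lemma restrict_id e J : supp e \subset J -> restrict e J = e.
Proof.
move=> s; rewrite -{1}(restrict_supp e) restrict_restrict (setIidPl s).
exact: restrict_supp.
Qed.

Lemma restrict_set0 e : restrict e set0 = void_edge.
Proof. by apply/ffunP => i; rewrite !ffunE inE. Qed.

End EdgeOperations.

Lemma forall_eq_equivalence (T U : Type) (C : eqType) (b : U -> Prop)
   (g : U -> T -> C) (rho : rel T) :
  (forall x y, reflect (forall u, b u -> g u x = g u y) (rho x y)) ->
  equivalence_rel rho.
Proof.
move=> h x y z; split; first exact/h.
move=> /h xy; apply/h/h => k u bu; first by rewrite -xy // k.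
by rewrite xy // k.
Qed.

Section Refinement.
Variables (r : nat) (Om : 'I_r -> finType).
Implicit Types (G : cgraph Om) (x y e f : gedge Om) (I J : {set 'I_r}).

Definition point : finType := {i : 'I_r & Om i}.

Definition img m (phi : Phi Om m) : {set point} :=
  [set u : point | [exists j, phi (tag u) j == tagged u]].

Definition inside (Q : {set point}) (f : gedge Om) : bool :=
  [forall i, if f i is Some u then (Tagged Om u : point) \in Q else true].

Lemma in_imgE m (phi : Phi Om m) f : in_img phi f = inside (img phi) f.
Proof. by apply: eq_forallb => i; case: (f i) => // u; rewrite inE. Qed.

Lemma insideS (Q Q' : {set point}) f : Q \subset Q' -> inside Q f -> inside Q' f.
Proof.
move=> /subsetP s /forallP h; apply/forallP => i; have := h i.
by case: (f i) => // u /s.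
Qed.

Lemma inside_eunion Q e f : inside Q e -> inside Q f -> inside Q (eunion e f).
Proof.
move=> /forallP he /forallP hf; apply/forallP => i; rewrite ffunE.
by have := he i; case: (e i).
Qed.

Lemma inside_void Q : inside Q (void_edge Om).
Proof. by apply/forallP => i; rewrite ffunE. Qed.

Lemma img_cat m n (phi : Phi Om m) (psi : Phi Om n) :
  img (cat_phi phi psi) = img phi :|: img psi.
Proof.
apply/setP => -[i u]; rewrite !inE /=; apply/existsP/orP.
  move=> [j]; rewrite !ffunE; case: split_ordP => a _ h.
    by left; apply/existsP; exists a.
  by right; apply/existsP; exists a.
move=> [] /existsP [j /eqP <-].
  by exists (lshift n j); rewrite !ffunE (_ : split _ = inl j) //; exact: (@unsplitK m n (inl j)).
by exists (rshift m j); rewrite !ffunE (_ : split _ = inr j) //; exact: (@unsplitK m n (inr j)).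
Qed.

Definition frame_rel G I : rel (gedge Om) := fun x y =>
  [forall J : {set 'I_r}, ((J != set0) && (J \proper I)) ==>
     (col G (restrict x J) == col G (restrict y J))].

(* Equality of the frame colours of index-[I] edges after a recolouring of
   level [j - 1] in which [Q] is the set of sampled points. *)
Definition ext_rel G (j : nat) I (Q : {set point}) : rel (gedge Om) := fun x y =>
  [forall J : {set 'I_r}, forall f : gedge Om,
     [&& J != set0, J \proper I, [disjoint supp f & J],
         (#|J| + #|supp f| <= j)%N & inside Q f] ==>
     (col G (eunion (restrict x J) f) == col G (eunion (restrict y J) f))].

Lemma frame_relP G I x y :
  reflect (forall J, J != set0 -> J \proper I ->
             col G (restrict x J) = col G (restrict y J)) (frame_rel G I x y).
Proof.
apply: (iffP forallP) => h J.
  by move=> J0 JI; apply/eqP; have := h J; rewrite J0 JI.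
by apply/implyP => /andP[J0 JI]; apply/eqP/h.
Qed.

Lemma ext_relP G j I Q x y :
  reflect (forall J f, J != set0 -> J \proper I -> [disjoint supp f & J] ->
             (#|J| + #|supp f| <= j)%N -> inside Q f ->
             col G (eunion (restrict x J) f) = col G (eunion (restrict y J) f))
          (ext_rel G j I Q x y).
Proof.
apply: (iffP forallP) => h J.
  move=> f J0 JI d c i; apply/eqP; have /forallP /(_ f) := h J.
  by rewrite J0 JI d c i.
apply/forallP => f; apply/implyP => /and5P[J0 JI d c i]; exact/eqP/h.
Qed.

Lemma frame_rel_equiv G I : equivalence_rel (frame_rel G I).
Proof.
apply: (@forall_eq_equivalence _ {set 'I_r} _
  (fun J => J != set0 /\ J \proper I) (fun J x => col G (restrict x J))) => x y.
by apply: (iffP (frame_relP _ _ _ _)) => [h J []|h J *]; apply: h.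
Qed.

Lemma ext_rel_equiv G j I Q : equivalence_rel (ext_rel G j I Q).
Proof.
apply: (@forall_eq_equivalence _ ({set 'I_r} * gedge Om) _
  (fun u => [/\ u.1 != set0, u.1 \proper I, [disjoint supp u.2 & u.1],
             (#|u.1| + #|supp u.2| <= j)%N & inside Q u.2])
  (fun u x => col G (eunion (restrict x u.1) u.2))) => x y.
by apply: (iffP (ext_relP _ _ _ _ _ _)) => [h [J f] []|h J f *];
  [apply: h | apply: (h (J, f))].
Qed.

Lemma ext_rel_subset G j I (Q Q' : {set point}) x y :
  Q \subset Q' -> ext_rel G j I Q' x y -> ext_rel G j I Q x y.
Proof.
move=> s /ext_relP h; apply/ext_relP => J f J0 JI d c i; apply: h => //.
exact: insideS i.
Qed.

Lemma ext_rel_frame G j I Q x y :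
  (#|I| <= j)%N -> ext_rel G j I Q x y -> frame_rel G I x y.
Proof.
move=> Ij /ext_relP h; apply/frame_relP => J J0 JI.
have := h J (void_edge Om); rewrite !eunion_void supp_void cards0 addn0; apply => //.
- by rewrite disjoint_sym -setI_eq0 setI0.
- exact: leq_trans (ltnW (proper_card JI)) Ij.
- exact: inside_void.
Qed.


Lemma ext_rel_singleton G j I Q x y : (#|I| <= 1)%N -> ext_rel G j I Q x y.
Proof.
move=> I1; apply/ext_relP => J f J0 /proper_card JI; exfalso.
by move: J0; rewrite -card_gt0; move: (leq_trans JI I1); rewrite ltnS leqn0 => /eqP ->.
Qed.

Section Recolouring.
Variables (m s : nat) (phi : Phi Om m) (G : cgraph Om).
Let H := regularize phi G s.

Lemma col_regularize_small x y : supp x = supp y -> (#|supp x| <= s)%N ->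
  (col H x == col H y) =
  [forall f, admissible phi s (supp x) f ==>
      (col G (eunion x f) == col G (eunion y f))].
Proof.
move=> sxy sx; rewrite /H /= -sxy sx; apply/eqP/forallP.
  move=> [] /ffunP h f; apply/implyP => a; have := h f.
  by rewrite !ffunE -sxy a => -[->].
move=> h; congr inr; apply/ffunP => f; rewrite !ffunE -sxy; case: ifP => // a.
by congr Some; apply/eqP; have := h f; rewrite a.
Qed.

Lemma col_regularize_large x y : supp x = supp y -> (s < #|supp x|)%N ->
  (col H x == col H y) = (col G x == col G y).
Proof.
by move=> sxy; rewrite ltnNge /H /= -sxy => /negPf ->; apply/eqP/eqP => [[]|->].
Qed.

Lemma admissible_void I : (#|I| <= s.+1)%N -> admissible phi s I (void_edge Om).
Proof.
move=> c; rewrite /admissible supp_void cards0 addn0 c in_imgE inside_void.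
by rewrite -setI_eq0 set0I eqxx.
Qed.

Lemma col_regularize_finer x y : supp x = supp y ->
  col H x = col H y -> col G x = col G y.
Proof.
move=> sxy /eqP; have [c|c] := leqP #|supp x| s; last first.
  by rewrite col_regularize_large // => /eqP.
rewrite col_regularize_small // => /forallP /(_ (void_edge Om)).
by rewrite admissible_void ?(leqW c) // !eunion_void => /eqP.
Qed.

Lemma frame_regularize_coarse I x y : supp x = I -> supp y = I ->
  frame_rel H I x y -> frame_rel G I x y.
Proof.
move=> sx sy /frame_relP h; apply/frame_relP => J J0 JI.
by apply: col_regularize_finer; rewrite ?supp_restrict ?sx ?sy ?h.
Qed.

(** At size [s.+1] the size limits in [admissible] and in [ext_rel] coincide: recolouring at level
    [s] makes the frame colours remember all extensions by sampled points. *)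
Lemma frame_regularize_ext I x y : supp x = I -> supp y = I -> #|I| = s.+1 ->
  frame_rel H I x y -> ext_rel G s.+1 I (img phi) x y.
Proof.
move=> sx sy cI /frame_relP h; apply/ext_relP => J f J0 JI d c i.
have sJ z : supp z = I -> supp (restrict z J) = J.
  by move=> sz; rewrite supp_restrict sz; apply/setIidPl/proper_sub.
have /eqP := h J J0 JI; rewrite col_regularize_small ?sJ //; last first.
  by rewrite -ltnS -cI proper_card.
by move=> /forallP /(_ f); rewrite /admissible d c in_imgE i => /eqP.
Qed.

(** A new colour of an edge extended by [f] is either its old colour or a vector of old colours of
    the edge extended by [f] and some sampled [g]. In the latter case the total size is at most
    [s.+1 <= j], so these are again extensions allowed at size [j]. Lower recolourings are thus
    absorbed once their points belong to [Q]. *)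
Lemma ext_rel_regularize j I (Q : {set point}) x y : supp x = I -> supp y = I -> (s < j)%N ->
  img phi \subset Q -> ext_rel G j I Q x y -> ext_rel H j I Q x y.
Proof.
move=> sx sy sj pQ /ext_relP h; apply/ext_relP => J f J0 JI d c i.
have sJ z : supp z = I -> supp (restrict z J) = J.
  by move=> sz; rewrite supp_restrict sz; apply/setIidPl/proper_sub.
have se : supp (eunion (restrict x J) f) = supp (eunion (restrict y J) f).
  by rewrite !supp_eunion !sJ.
apply/eqP; have [le_s|gt_s] := leqP #|supp (eunion (restrict x J) f)| s; last first.
  by rewrite col_regularize_large //; apply/eqP; apply: h.
rewrite col_regularize_small //; apply/forallP => g; apply/implyP.
rewrite /admissible supp_eunion sJ // => /andP[/andP[dg cg] ig].
rewrite !eunionA; apply/eqP; apply: h => //.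
- rewrite supp_eunion -setI_eq0 setIUl setU_eq0 !setI_eq0 d /=.
  by apply: disjointWr dg; exact: subsetUl.
- apply: leq_trans sj; apply: leq_trans cg; rewrite supp_eunion.
  rewrite [X in (_ <= X + _)%N]cardsU.
  have -> : J :&: supp f = set0 by apply/eqP; rewrite setI_eq0 disjoint_sym.
  by rewrite cards0 subn0 -addnA leq_add2l cardsU leq_subr.
- by apply: inside_eunion => //; rewrite in_imgE in ig; exact: insideS ig.
Qed.

(** In each part an admissible [f] has no vertex or one of at most [m] sampled ones. *)
Lemma card_admissible I : (#|[set f | admissible phi s I f]| <= m.+1 ^ r)%N.
Proof.
pose F (u : {ffun 'I_r -> option 'I_m}) : gedge Om := [ffun i => omap (phi i) (u i)].
apply: (@leq_trans #|[set F u | u in [set: {ffun 'I_r -> option 'I_m}]]|).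
  apply: subset_leq_card; apply/subsetP => f; rewrite inE => /andP[_ /forallP i].
  apply/imsetP; exists [ffun a => if f a is Some v then [pick j | phi a j == v] else None].
    by rewrite inE.
  apply/ffunP => a; rewrite !ffunE; have := i a; case: (f a) => // v /existsP[j pj].
  by case: pickP => [b /eqP <-|/(_ j)] //; rewrite pj.
apply: leq_trans (leq_imset_card _ _) _.
by rewrite cardsT card_ffun card_option !card_ord.
Qed.

Lemma Cset_regularize_large I : (s < #|I|)%N -> #|Cset H I| = #|Cset G I|.
Proof.
by rewrite ltnNge /H /= => /negPf ->; rewrite card_imset // => x y [].
Qed.

Lemma Cset_regularize_small I a :
  (#|I| <= s)%N ->
  (forall J, I \subset J -> (#|J| <= s.+1)%N -> (#|Cset G J| <= a)%N) ->
  (0 < a)%N -> (#|Cset H I| <= a ^ (m.+1 ^ r))%N.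
Proof.
move=> cI ha a0; rewrite /H /= cI card_imset; last by move=> x y [].
pose F (f : gedge Om) : pred (option (Col G)) :=
  if admissible phi s I f then fun o => o \in [set Some c | c in Cset G (I :|: supp f)]
  else pred1 None.
apply: (@leq_trans #|family F|).
  apply: subset_leq_card; apply/subsetP => g; rewrite inE => /forallP h.
  apply/familyP => f; have := h f; rewrite /F; case: ifP => // _.
  by case: (g f) => // c hc; apply/imsetP; exists c.
rewrite card_family foldrE big_map big_enum /=.
apply: (@leq_trans (\prod_(f : gedge Om | f \in [set f | admissible phi s I f]) a)).
  rewrite [leqRHS]big_mkcond /=; apply: leq_prod => f _; rewrite inE /F.
  case: ifP => adm; last by rewrite card1.
  rewrite (@eq_card _ _ [set Some c | c in Cset G (I :|: supp f)]) //.
  rewrite card_imset; last by move=> c d [].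
  apply: ha; first exact: subsetUl.
  by move: adm => /andP[/andP[_ cf] _]; apply: leq_trans cf; rewrite cardsU leq_subr.
by rewrite prod_nat_const leq_pexp2l // card_admissible.
Qed.

Lemma col_regularize_Cset x :
  (forall e, supp x \subset supp e -> (#|supp e| <= maxn s.+1 #|supp x|)%N ->
     col G e \in Cset G (supp e)) ->
  col H x \in Cset H (supp x).
Proof.
move=> h; rewrite /H /=; case: ifP => c; last first.
  by rewrite imset_f // h // leq_maxr.
apply: imset_f; rewrite inE; apply/forallP => f; rewrite ffunE.
case: ifP => [|->] // adm; rewrite adm -supp_eunion h ?supp_eunion ?subsetUl //.
rewrite leq_max; apply/orP; left.
by move: adm => /andP[/andP[_ cf] _]; apply: leq_trans cf; rewrite cardsU leq_subr.
Qed.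

End Recolouring.
End Refinement.

Section ImageExpectation.
Variables (R : realType) (r : nat) (Om : 'I_r -> finType)
          (P : forall i : 'I_r, Om i -> R).
Hypothesis Pprob : isProbs P.

Definition Eimg (m : nat) (F : {set point Om} -> R) : R :=
  Ephi P (fun phi : Phi Om m => F (img phi)).

Lemma Eimg_add m n F : Eimg (m + n) F = Eimg m (fun Q => Eimg n (fun Q' => F (Q :|: Q'))).
Proof.
rewrite /Eimg Ephi_cat //; apply: eq_Ephi => phi; apply: eq_Ephi => psi.
by rewrite img_cat.
Qed.

Lemma eq_Eimg m (F F' : {set point Om} -> R) : F =1 F' -> Eimg m F = Eimg m F'.
Proof. by move=> e; apply: eq_Ephi => phi; rewrite e. Qed.

Lemma Eimg_mono m n (F : {set point Om} -> R) :
  (forall Q Q' : {set point Om}, Q \subset Q' -> F Q <= F Q') -> (m <= n)%N -> Eimg m F <= Eimg n F.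
Proof.
move=> mono /subnKC <-; rewrite Eimg_add; apply: le_Ephi => // phi.
by rewrite -(Ephi_cst Pprob (n - m) (F (img phi))); apply: le_Ephi => // psi;
   apply: mono; exact: subsetUl.
Qed.

Definition level_energy (G : cgraph Om) (j : nat) (Q : {set point Om}) : R :=
  \sum_(I : {set 'I_r} | #|I| == j) energy (iweight P I) (col G) (ext_rel G j I Q).

Lemma level_energy_mono G j (Q Q' : {set point Om}) :
  Q \subset Q' -> level_energy G j Q <= level_energy G j Q'.
Proof.
move=> s; apply: ler_sum => I _; apply: energy_mono.
- exact: iweight_ge0.
- exact: ext_rel_equiv.
- exact: ext_rel_equiv.
- move=> x y _ _; exact: ext_rel_subset.
Qed.

Lemma level_energy_ge0 G j Q : 0 <= level_energy G j Q.
Proof. by apply: sumr_ge0 => I _; apply: energy_ge0; exact: iweight_ge0. Qed.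

Lemma level_energy_le G j Q : level_energy G j Q <= (2 ^ r)%:R.
Proof.
apply: (@le_trans _ _ (\sum_(I : {set 'I_r}) 1)).
  rewrite [leRHS](bigID (fun I : {set 'I_r} => #|I| == j)) /=.
  rewrite -[leLHS]addr0; apply: lerD; last exact: sumr_ge0.
  apply: ler_sum => I _; rewrite -(iweight_sum1 Pprob I).
  apply: energy_le; [exact: iweight_ge0 | exact: ext_rel_equiv].
by rewrite sumr_const -cardsT -powersetT card_powerset cardsT card_ord.
Qed.

End ImageExpectation.

(** * Counting simplicial complexes *)

Section EdgeMaps.
Variables (r : nat) (Om : 'I_r -> finType).

Definition emap a b (s : 'I_r -> 'I_a -> 'I_b) (e : sedge r a) : sedge r b :=
  [ffun i => omap (s i) (e i)].

Lemma supp_emap a b (s : 'I_r -> 'I_a -> 'I_b) e : supp (emap s e) = supp e.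
Proof. by apply/setP => i; rewrite !inE ffunE; case: (e i). Qed.

Lemma restrict_emap a b (s : 'I_r -> 'I_a -> 'I_b) e J :
  restrict (emap s e) J = emap s (restrict e J).
Proof. by apply/ffunP => i; rewrite !ffunE; case: (i \in J). Qed.

Lemma emap_comp a b c (s : 'I_r -> 'I_a -> 'I_b) (t : 'I_r -> 'I_b -> 'I_c) e :
  emap t (emap s e) = emap (fun i v => t i (s i v)) e.
Proof. by apply/ffunP => i; rewrite !ffunE; case: (e i). Qed.

Lemma emap_id a (s : 'I_r -> 'I_a -> 'I_a) e : (forall i v, s i v = v) -> emap s e = e.
Proof. by move=> h; apply/ffunP => i; rewrite !ffunE; case: (e i) => //= v; rewrite h. Qed.

Lemma phimap_reindex a b (s : 'I_r -> 'I_a -> 'I_b) (phi : Phi Om b) e :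
  phimap (reindex_phi s phi) e = phimap phi (emap s e).
Proof. by apply/ffunP => i; rewrite !ffunE; case: (e i) => //= v; rewrite !ffunE. Qed.

Lemma restrict_phimap a (phi : Phi Om a) (e : sedge r a) J :
  restrict (phimap phi e) J = phimap phi (restrict e J).
Proof. by apply/ffunP => i; rewrite !ffunE; case: (i \in J). Qed.

Lemma eq_phimap a b (phi : Phi Om a) (psi : Phi Om b) (e : sedge r a) (e' : sedge r b) :
  (forall i, omap (phi i) (e i) = omap (psi i) (e' i)) -> phimap phi e = phimap psi e'.
Proof. by move=> h; apply/ffunP => i; rewrite !ffunE; exact: h. Qed.

End EdgeMaps.

Section Complexes.
Variables (R : realType) (r : nat) (Om : 'I_r -> finType)
          (P : forall i : 'I_r, Om i -> R).
Hypothesis Pprob : isProbs P.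
Variable H : cgraph Om.
Implicit Types (x y : gedge Om) (I J : {set 'I_r}).

Definition dens x : R :=
  cexp (iweight P (supp x)) (frame_rel H (supp x))
       (fun y => (col H y == col H x)%:R) x.

Section Complex.
Variable n : nat.
Implicit Types (S : sedge r n -> option (Col H)) (e : sedge r n).

Definition vis S e : bool := (0 < #|supp e|)%N && (S e != None).

Definition matches S (phi : Phi Om n) : bool :=
  [forall e, vis S e ==> (Some (col H (phimap phi e)) == S e)].

Definition cprob S : R := Ephi P (fun phi : Phi Om n => (matches S phi)%:R).

Definition sdens S e : R := reldens P (supp e) (stcol S e).

Definition realizes S e x : Prop := supp x = supp e /\
  forall J, J != set0 -> J \subset supp e ->
    S (restrict e J) = Some (col H (restrict x J)).

Definition subcomplex S (p : pred (sedge r n)) e : option (Col H) :=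
  if p e then S e else None.

Lemma vis_subcomplex S p e : vis (subcomplex S p) e = vis S e && p e.
Proof. by rewrite /vis /subcomplex; case: (p e); rewrite ?andbT ?andbF. Qed.

Lemma matches_subcomplex S (p q : pred (sedge r n)) phi :
  (forall e, vis S e -> p e -> q e) ->
  matches (subcomplex S q) phi -> matches (subcomplex S p) phi.
Proof.
move=> pq /forallP h; apply/forallP => e; rewrite vis_subcomplex.
apply/implyP => /andP[v pe]; have := h e.
by rewrite vis_subcomplex v pq //= /subcomplex pe pq.
Qed.

Lemma cprob_ge0 S : 0 <= cprob S.
Proof. by apply: Ephi_ge0 => // phi; rewrite ler0n. Qed.

Lemma cprob_le1 S : cprob S <= 1.
Proof.
rewrite -(Ephi_cst Pprob n 1); apply: le_Ephi => // phi; by rewrite lern1 leq_b1.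
Qed.

Lemma realizes_stcol S e x : realizes S e x -> stcol S e = tcol H x.
Proof.
move=> [sx h]; apply/ffunP => J; rewrite !ffunE sx; case: ifP => // /andP[].
exact: h.
Qed.

Lemma stcol_realizes S e x : supp x = supp e -> stcol S e = tcol H x -> realizes S e x.
Proof.
move=> sx /ffunP h; split => // J J0 Js; have := h J.
by rewrite !ffunE sx J0 Js.
Qed.

Lemma realizes_sub S (p : pred (sedge r n)) e x : p e ->
  (forall J, J != set0 -> J \subset supp e -> p e -> p (restrict e J)) ->
  realizes S e x -> realizes (subcomplex S p) e x.
Proof.
move=> pe pc [sx h]; split => // J J0 Js.
by rewrite /subcomplex pc // h.
Qed.

Lemma stcol_sub S (p : pred (sedge r n)) e : p e ->
  (forall J, J != set0 -> J \subset supp e -> p e -> p (restrict e J)) ->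
  stcol (subcomplex S p) e = stcol S e.
Proof.
move=> pe pc; apply/ffunP => J; rewrite !ffunE; case: ifP => // /andP[J0 Js].
by rewrite /subcomplex pc.
Qed.

Lemma realizes_self S e x : (0 < #|supp e|)%N -> realizes S e x -> S e = Some (col H x).
Proof.
move=> e0 [sx h]; have := h (supp e); rewrite restrict_supp -sx restrict_supp.
by apply; rewrite // sx -card_gt0.
Qed.

End Complex.

Lemma tcol_supp x y : (0 < #|supp x|)%N -> (0 < #|supp y|)%N ->
  tcol H x = tcol H y -> supp x = supp y.
Proof.
move=> x0 y0 e; apply/eqP; rewrite eqEsubset.
have sub z t : (0 < #|supp z|)%N -> tcol H z = tcol H t -> supp z \subset supp t.
  move=> z0 /ffunP /(_ (supp z)); rewrite !ffunE subxx -card_gt0 z0 /=.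
  by case: ifP.
by rewrite !sub.
Qed.

Lemma frame_matchE x y : supp y = supp x ->
  frame_match y (tcol H x) = frame_rel H (supp x) x y.
Proof.
move=> sy; apply: eq_forallb => J; rewrite sy !ffunE sy.
case: andP => //= -[J0 /proper_sub Jx]; rewrite J0 Jx /= eq_sym.
by rewrite (inj_eq Some_inj).
Qed.

Lemma tcol_eqE x y : supp y = supp x -> (0 < #|supp x|)%N ->
  (tcol H y == tcol H x) = frame_rel H (supp x) x y && (col H y == col H x).
Proof.
move=> sy x0; apply/eqP/andP => [/ffunP e|[/frame_relP h /eqP c]].
  split.
    apply/frame_relP => J J0 /proper_sub Jx; have := e J.
    by rewrite !ffunE sy J0 Jx /= => -[->].
  have := e (supp x); rewrite !ffunE sy subxx -card_gt0 x0 /= restrict_supp.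
  by rewrite -sy restrict_supp => -[->].
apply/ffunP => J; rewrite !ffunE sy; case: ifP => // /andP[J0 Jx].
have [->|nJ] := eqVneq J (supp x); last first.
  by congr Some; rewrite h // properEneq nJ.
by rewrite restrict_supp -{1}sy restrict_supp c.
Qed.

(** The two formulas differ only in the default for a frame class of weight zero, 0 for [dens] and 1
    for [reldens]; [dens x != 0] excludes that case. *)
Lemma reldens_tcol x : (0 < #|supp x|)%N -> dens x != 0 ->
  reldens P (supp x) (tcol H x) = dens x.
Proof.
move=> x0; rewrite /dens /cexp /reldens.
have -> : \sum_(e | (supp e == supp x) && frame_match e (tcol H x)) eweight P e =
  \sum_(y | frame_rel H (supp x) x y) iweight P (supp x) y.
  rewrite [LHS]big_mkcond [RHS]big_mkcond; apply: eq_bigr => y _; rewrite /iweight.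
  by case: eqP => [sy|_] /=; rewrite ?if_same // frame_matchE.
set W := \sum_(y | _) iweight P _ y.
have [->|_ _] := eqVneq W 0; first by rewrite invr0 mulr0 eqxx.
congr (_ / _); rewrite [LHS]big_mkcond [RHS]big_mkcond; apply: eq_bigr => y _.
rewrite /iweight; case: eqP => [sy|]; rewrite ?mul0r ?if_same //= tcol_eqE //.
by case: (frame_rel _ _ _ _) => //=; case: (col H y == col H x); rewrite ?mulr1 ?mulr0.
Qed.


Lemma dens_le1 x : dens x <= 1.
Proof.
by apply: cexp_le1 => [y|y]; rewrite ?iweight_ge0 // lern1 leq_b1.
Qed.

End Complexes.

(** * Doubling a complex along an edge *)

Section Doubling.
Variables (r : nat) (Om : 'I_r -> finType) (H : cgraph Om).
Variables (n : nat) (S : sedge r n -> option (Col H)) (e0 : sedge r n).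

(* Two copies of the vertex set ['I_n], glued along the vertices of [e0]. *)
Definition glue_fst (i : 'I_r) (v : 'I_n) : 'I_(n + n) := lshift n v.
Definition glue_snd (i : 'I_r) (v : 'I_n) : 'I_(n + n) :=
  if e0 i == Some v then lshift n v else rshift n v.
(** A common left inverse of both gluing maps. The right copies of the vertices of [e0] are hit by
    neither map, so edges through them are invisible in [doubled]. *)
Definition unglue (i : 'I_r) (w : 'I_(n + n)) : 'I_n :=
  match split w with inl v | inr v => v end.

Lemma glue_fstK i : cancel (glue_fst i) (unglue i).
Proof. by move=> v; rewrite /unglue /glue_fst (_ : split _ = inl v) //; exact: (@unsplitK n n (inl v)). Qed.

Lemma glue_sndK i : cancel (glue_snd i) (unglue i).
Proof.
move=> v; rewrite /glue_snd; case: ifP => _; first exact: glue_fstK.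
by rewrite /unglue (_ : split _ = inr v) //; exact: (@unsplitK n n (inr v)).
Qed.

Lemma emap_glue_fstK e : emap unglue (emap glue_fst e) = e.
Proof. by rewrite emap_comp emap_id // => i v; exact: glue_fstK. Qed.

Lemma emap_glue_sndK e : emap unglue (emap glue_snd e) = e.
Proof. by rewrite emap_comp emap_id // => i v; exact: glue_sndK. Qed.

Definition doubled (E : sedge r (n + n)) : option (Col H) :=
  let e := emap unglue E in
  if (E == emap glue_fst e) || (E == emap glue_snd e) then S e else None.

Lemma doubled_fst e : doubled (emap glue_fst e) = S e.
Proof. by rewrite /doubled emap_glue_fstK eqxx. Qed.

Lemma doubled_snd e : doubled (emap glue_snd e) = S e.
Proof. by rewrite /doubled emap_glue_sndK eqxx orbT. Qed.

Lemma vis_doubled E : vis doubled E = vis S (emap unglue E) &&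
  ((E == emap glue_fst (emap unglue E)) || (E == emap glue_snd (emap unglue E))).
Proof.
by rewrite /vis supp_emap /doubled; case: ifP; rewrite ?andbT // !andbF.
Qed.

Lemma stcol_doubled E : vis doubled E -> stcol doubled E = stcol S (emap unglue E).
Proof.
rewrite vis_doubled => /andP[_ h]; apply/ffunP => J.
rewrite !ffunE supp_emap; case: ifP => // _.
move: h => /orP[] /eqP {1}->.
  by rewrite restrict_emap doubled_fst.
by rewrite restrict_emap doubled_snd.
Qed.

Lemma matches_doubled (phi : Phi Om (n + n)) :
  matches doubled phi =
  matches S (reindex_phi glue_fst phi) && matches S (reindex_phi glue_snd phi).
Proof.
apply/forallP/andP => [h|[/forallP h1 /forallP h2] E].
  split; apply/forallP => e; rewrite phimap_reindex.
    have := h (emap glue_fst e).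
    by rewrite doubled_fst vis_doubled emap_glue_fstK eqxx andbT.
  have := h (emap glue_snd e).
  by rewrite doubled_snd vis_doubled emap_glue_sndK eqxx orbT andbT.
apply/implyP; rewrite vis_doubled => /andP[v /orP[] /eqP eE]; rewrite eE.
  by rewrite doubled_fst -phimap_reindex; move: (h1 (emap unglue E)); rewrite v.
by rewrite doubled_snd -phimap_reindex; move: (h2 (emap unglue E)); rewrite v.
Qed.

(** An edge whose two copies coincide gives one factor, any other edge two. By [glue_eq_restrict]
    below, the copies coincide exactly for the edges inside [e0]. *)
Lemma prod_doubled (R : comPzSemiRingType) (F : sedge r n -> R) :
  \prod_(E | vis doubled E) F (emap unglue E) =
  (\prod_(e | vis S e) F e) *
  (\prod_(e | vis S e && (emap glue_fst e != emap glue_snd e)) F e).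
Proof.
rewrite (bigID (fun E => E == emap glue_fst (emap unglue E))) /=; congr (_ * _).
  rewrite (reindex_onto (emap glue_fst) (emap unglue)); last first.
    by move=> E /andP[_ /eqP].
  apply: eq_big => [e|e _]; last by rewrite emap_glue_fstK.
  by rewrite vis_doubled emap_glue_fstK !eqxx !andbT.
rewrite (reindex_onto (emap glue_snd) (emap unglue)); last first.
  move=> E; rewrite vis_doubled => /andP[/andP[_ /orP[-> //|/eqP]]].
  by move=> <-.
apply: eq_big => [e|e _]; last by rewrite emap_glue_sndK.
by rewrite vis_doubled emap_glue_sndK !eqxx orbT !andbT eq_sym.
Qed.

Lemma glue_eq_restrict e :
  (emap glue_fst e == emap glue_snd e) = (restrict e0 (supp e) == e).
Proof.
apply/eqP/eqP => /ffunP h; apply/ffunP => i; have := h i; rewrite !ffunE inE.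
  case: (e i) => //= v /Some_inj /eqP; rewrite /glue_fst /glue_snd.
  by case: (e0 i =P Some v) => [-> //|_]; rewrite eq_lrshift.
by case: (e i) => //= v ev; congr Some; rewrite /glue_snd ev eqxx.
Qed.

End Doubling.

(** * Disjoint fresh copies and their second moment *)

Section FreshCopies.
Variables (R : realType) (r : nat) (Om : 'I_r -> finType)
          (P : forall i : 'I_r, Om i -> R).
Hypothesis Pprob : isProbs P.
Variables (H : cgraph Om) (n N L : nat).
Hypothesis NnL : (N * n <= L)%N.
Variable e0 : sedge r n.

Lemma fresh_subproof (t : 'I_N) (v : 'I_n) : (t * n + v < L)%N.
Proof.
apply: leq_trans NnL; apply: (@leq_trans (t.+1 * n)); last by rewrite leq_mul2r ltn_ord orbT.
by rewrite mulSn addnC ltn_add2r.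
Qed.

Definition fresh (t : 'I_N) (v : 'I_n) : 'I_L := Ordinal (fresh_subproof t v).

Lemma fresh_inj t t' v v' : fresh t v = fresh t' v' -> t = t' /\ v = v'.
Proof.
move=> /(congr1 val) /= e; have n0 : (0 < n)%N by apply: leq_ltn_trans (ltn_ord v).
have tt : t = t'.
  apply: val_inj => /=; move: (congr1 (divn^~ n) e).
  by rewrite !divnMDl // !divn_small ?ltn_ord // !addn0.
by split=> //; apply: val_inj; move: e; rewrite tt => /addnI.
Qed.

(* The [t]-th copy keeps the vertices of [e0]; all others are fresh. *)
Definition mix t (i : 'I_r) (v : 'I_n) : 'I_(n + L) :=
  if e0 i == Some v then lshift L v else rshift n (fresh t v).

(** Two copies agree on the vertices of [e0] and, for [t != t'], are otherwise disjoint; a pair of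
    copies is therefore one copy of the doubled complex. *)
Definition mix2 t t' (i : 'I_r) (w : 'I_(n + n)) : 'I_(n + L) :=
  match split w with inl v => mix t i v | inr v => rshift n (fresh t' v) end.

Lemma mix_inj t i : injective (mix t i).
Proof.
move=> v v'; rewrite /mix; case: ifP => _; case: ifP => _ /eqP.
- by rewrite eq_lshift => /eqP.
- by rewrite eq_lrshift.
- by rewrite eq_rlshift.
- by rewrite eq_rshift => /eqP /fresh_inj [].
Qed.

Lemma mix2_inj t t' i : t != t' -> injective (mix2 t t' i).
Proof.
move=> tt w w'; rewrite /mix2.
case: (split_ordP w) => v ->; case: (split_ordP w') => v' ->.
- by move=> /mix_inj ->.
- rewrite /mix; case: ifP => _ /eqP; rewrite ?eq_lrshift // eq_rshift => /eqP /fresh_inj [] e.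
  by rewrite e eqxx in tt.
- rewrite /mix; case: ifP => _ /eqP; rewrite ?eq_rlshift // eq_rshift => /eqP /fresh_inj [] e.
  by rewrite e eqxx in tt.
- by move=> /eqP; rewrite eq_rshift => /eqP /fresh_inj [] _ ->.
Qed.

Lemma reindex_mix2_fst t t' (Z : Phi Om (n + L)) :
  reindex_phi (@glue_fst r n) (reindex_phi (mix2 t t') Z) = reindex_phi (mix t) Z.
Proof.
apply/ffunP => i; apply/ffunP => v; rewrite !ffunE /mix2 /glue_fst.
by rewrite (_ : split _ = inl v) //; exact: (@unsplitK n n (inl v)).
Qed.

Lemma reindex_mix2_snd t t' (Z : Phi Om (n + L)) :
  reindex_phi (glue_snd e0) (reindex_phi (mix2 t t') Z) = reindex_phi (mix t') Z.
Proof.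
apply/ffunP => i; apply/ffunP => v; rewrite !ffunE /mix2 /glue_snd {2}/mix.
case: ifP => h.
  rewrite (_ : split _ = inl v) ?/mix ?h //; exact: (@unsplitK n n (inl v)).
by rewrite (_ : split _ = inr v) //; exact: (@unsplitK n n (inr v)).
Qed.

Definition copies (S : sedge r n -> option (Col H)) (Z : Phi Om (n + L)) : R :=
  (N%:R)^-1 * \sum_(t < N) (matches S (reindex_phi (mix t) Z))%:R.

(** Off the diagonal the product of two indicators is the indicator of the doubled complex. The
    diagonal has only [N] of the [N ^ 2] terms, hence its factor [1 / N]. *)
Lemma copies_second_moment S : (0 < N)%N ->
  Ephi P (fun Z => copies S Z ^+ 2) <=
    (N%:R)^-1 * cprob P S + cprob P (doubled S e0).
Proof.
move=> N0; have N0' : (N%:R : R) != 0 by rewrite pnatr_eq0 -lt0n.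
have -> : Ephi P (fun Z => copies S Z ^+ 2) = (N%:R)^-1 ^+ 2 * \sum_(t < N) \sum_(t' < N)
   Ephi P (fun Z : Phi Om (n + L) => (matches S (reindex_phi (mix t) Z))%:R *
           (matches S (reindex_phi (mix t') Z))%:R).
  under [in RHS]eq_bigr do rewrite -Ephi_sum.
  rewrite -Ephi_sum -EphiZ; apply: eq_Ephi => Z; rewrite /copies exprMn; congr (_ * _).
  by rewrite expr2 big_distrlr.
have bound (t t' : 'I_N) : Ephi P (fun Z : Phi Om (n + L) =>
     (matches S (reindex_phi (mix t) Z))%:R * (matches S (reindex_phi (mix t') Z))%:R)
   <= (t == t')%:R * cprob P S + cprob P (doubled S e0).
  have [<-|tt] := eqVneq t t'.
    rewrite mul1r -[leLHS]addr0; apply: lerD; last exact: cprob_ge0.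
    rewrite /cprob -(Ephi_reindex Pprob (s := mix t)); last exact: mix_inj.
    by apply: le_Ephi => // Z; rewrite -natrM mulnb andbb.
  rewrite mul0r add0r /cprob -(Ephi_reindex Pprob (s := mix2 t t')); last first.
    by move=> i; exact: mix2_inj.
  apply: le_Ephi => // Z.
  by rewrite matches_doubled reindex_mix2_fst reindex_mix2_snd -natrM mulnb.
apply: (@le_trans _ _ ((N%:R)^-1 ^+ 2 * \sum_(t < N) \sum_(t' < N)
     ((t == t')%:R * cprob P S + cprob P (doubled S e0)))).
  rewrite ler_wpM2l ?exprn_ge0 ?invr_ge0 ?ler0n //.
  by apply: ler_sum => t _; apply: ler_sum => t' _; exact: bound.
under eq_bigr => t _.
  rewrite big_split /= sumr_const card_ord (bigD1 t) //= eqxx mul1r big1 ?addr0; last first.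
    by move=> t' nt; rewrite eq_sym (negPf nt) mul0r.
  over.
rewrite sumr_const card_ord -mulr_natr -[_ *+ N]mulr_natr.
by rewrite le_eqVlt; apply/orP; left; apply/eqP; field.
Qed.

Lemma Ephi_mix t (F : Phi Om n -> R) :
  Ephi P (fun Z : Phi Om (n + L) => F (reindex_phi (mix t) Z)) = Ephi P F.
Proof. by apply: Ephi_reindex => // i; exact: mix_inj. Qed.

Lemma phimap_mix_base t (phi : Phi Om n) (Y : Phi Om L) :
  phimap (reindex_phi (mix t) (cat_phi phi Y)) e0 = phimap phi e0.
Proof.
apply: eq_phimap => i; case E: (e0 i) => [v|] //=; congr Some.
rewrite !ffunE /mix E eqxx (_ : split _ = inl v) //; exact: (@unsplitK n L (inl v)).
Qed.

(** This brings every edge of a copy into the form tested by [ext_rel]: a part of the image of [e0],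
    extended by points of [Y]. *)
Lemma phimap_mix t (phi : Phi Om n) (Y : Phi Om L) (e : sedge r n) :
  phimap (reindex_phi (mix t) (cat_phi phi Y)) e =
  eunion (restrict (phimap phi e0) [set i | (e i != None) && (e0 i == e i)])
         [ffun i => if e0 i == e i then None else omap (fun v => Y i (fresh t v)) (e i)].
Proof.
apply/ffunP => i; rewrite !ffunE inE.
case Ee: (e i) => [v|] /=; last by case: (e0 i).
rewrite !ffunE /mix; case: ifP => h.
  by rewrite (eqP h) /= (_ : split _ = inl v) //; exact: (@unsplitK n L (inl v)).
rewrite (_ : split _ = inr (fresh t v)) //; exact: (@unsplitK n L (inr (fresh t v))).
Qed.


End FreshCopies.

(** * The error of removing one edge *)

Section Deviation.
Variables (R : realType) (r : nat) (Om : 'I_r -> finType)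
          (P : forall i : 'I_r, Om i -> R).
Hypothesis Pprob : isProbs P.
Variables (H : cgraph Om) (L : nat).
(** The refinement is kept abstract: for sizes above 1 it will be an extension relation of an
    earlier graph, whose energy is the one that telescopes. *)
Variable kap : forall (I : {set 'I_r}) (Y : Phi Om L), rel (gedge Om).
Hypothesis kapE : forall I Y, equivalence_rel (kap I Y).
Hypothesis kap_ext : forall I Y x y, supp x = I -> supp y = I ->
  kap I Y x y -> ext_rel H #|I| I (img Y) x y.

Definition refined_dens I (Y : Phi Om L) (c : Col H) (x : gedge Om) : R :=
  cexp (iweight P I) (kap I Y) (fun y => (col H y == c)%:R) x.

(** Integrated over the frame class of [x0], without division by its mass [fmass x0]; [good]
    compares the two. *)
Definition dev (x0 : gedge Om) : R :=
  Ephi P (fun Y : Phi Om L => \sum_x iweight P (supp x0) x *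
    ((frame_rel H (supp x0) x0 x)%:R *
     (refined_dens (supp x0) Y (col H x0) x - dens P H x0) ^+ 2)).

Definition fmass (x0 : gedge Om) : R :=
  \sum_x iweight P (supp x0) x * (frame_rel H (supp x0) x0 x)%:R.

Lemma dev_ge0 x0 : 0 <= dev x0.
Proof.
apply: Ephi_ge0 => // Y; apply: sumr_ge0 => x _.
apply: mulr_ge0; first exact: iweight_ge0.
by apply: mulr_ge0; rewrite ?ler0n ?sqr_ge0.
Qed.

Section OneEdge.
Variables (n N : nat).
Hypothesis NnL : (N * n <= L)%N.
Hypothesis N_gt0 : (0 < N)%N.
Variables (S : sedge r n -> option (Col H)) (e0 : sedge r n) (x0 : gedge Om).
Hypothesis v0 : vis S e0.
Hypothesis real0 : realizes S e0 x0.
Hypothesis top0 : forall e, vis S e -> (#|supp e| <= #|supp e0|)%N.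

Let S' := subcomplex S (predC1 e0).

(** The edge [e] shares with [e0] only a proper part [J] of it: otherwise [e] contains [e0], and as
    [e0] has the largest size they coincide. The rest of [e] is fresh, so its colour is among those
    compared by [ext_rel]. *)
Lemma col_mix_invariant t (phi phi' : Phi Om n) (Y : Phi Om L) e :
  kap (supp e0) Y (phimap phi e0) (phimap phi' e0) -> vis S e -> e != e0 ->
  col H (phimap (reindex_phi (mix NnL e0 t) (cat_phi phi Y)) e) =
  col H (phimap (reindex_phi (mix NnL e0 t) (cat_phi phi' Y)) e).
Proof.
move=> /kap_ext /ext_relP h ve ne; rewrite !phimap_mix.
set J := [set i | _]; set f := [ffun i => _].
(* An edge sharing no vertex with [e0] does not depend on [phi] at all. *)
have [J0|J0] := eqVneq J set0; first by rewrite J0 !restrict_set0.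
have sf : supp f \subset supp e :\: J.
  apply/subsetP => i; rewrite !inE ffunE.
  by case: (e0 i =P e i) => [//|ne']; rewrite andbF; case: (e i).
apply: h; rewrite ?supp_phimap //.
- rewrite properEneq; apply/andP; split; last first.
    apply/subsetP => i; rewrite !inE => /andP[ei /eqP ->] //.
  apply: contra ne => /eqP JI.
  have sub : supp e0 \subset supp e.
    by rewrite -JI; apply/subsetP => i; rewrite !inE => /andP[].
  have es : supp e0 = supp e.
    by apply/eqP; rewrite eqEcard sub top0.
  apply/eqP/ffunP => i; have := erefl (i \in J); rewrite {1}JI !inE.
  case E: (e0 i == e i); first by rewrite (eqP E).
  rewrite andbF => /negbFE/eqP e0i; rewrite e0i.
  by move/setP: es => /(_ i); rewrite !inE e0i eqxx => /esym/negbFE/eqP.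
- rewrite -setI_eq0 -subset0; apply: subset_trans (setSI _ sf) _.
  by rewrite setIDAC setIC setDIl setDv set0I.
- apply: leq_trans (top0 ve); apply: leq_trans (leq_add (leqnn _) (subset_leq_card sf)) _.
  have Je : J \subset supp e by apply/subsetP => i; rewrite !inE => /andP[].
  by rewrite cardsD (setIidPr Je) subnKC // subset_leq_card.
- apply/forallP => i; rewrite ffunE; case: ifP => // _; case: (e i) => //= v.
  by rewrite inE; apply/existsP; exists (fresh NnL t v).
Qed.

Lemma matches_frame (phi : Phi Om n) :
  matches S' phi -> frame_rel H (supp e0) x0 (phimap phi e0).
Proof.
move=> /forallP h; apply/frame_relP => J J0 /[dup] JI /proper_sub Js.
have [sx hx] := real0; have := hx J J0 Js.
have sJ : supp (restrict e0 J) = J by rewrite supp_restrict; exact/setIidPl.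
have ne : restrict e0 J != e0.
  by apply: contraTneq JI => e; rewrite -{1}sJ e properxx.
have := h (restrict e0 J); rewrite vis_subcomplex /= ne andbT /S' /subcomplex /= ne.
move=> hm E; move: hm; rewrite /vis sJ card_gt0 J0 E /= => /eqP[].
by rewrite -restrict_phimap => ->.
Qed.

Lemma matches_split (phi : Phi Om n) :
  matches S phi = (col H (phimap phi e0) == col H x0) && matches S' phi.
Proof.
have [sx _] := real0; have e00 : (0 < #|supp e0|)%N by case/andP: v0.
have Se0 := realizes_self e00 real0.
apply/forallP/andP => [h|[/eqP c /forallP h] e].
  split.
    by have := h e0; rewrite v0 /= Se0 (inj_eq Some_inj).
  apply/forallP => e; rewrite vis_subcomplex; apply/implyP => /andP[ve ne].
  by have := h e; rewrite ve /S' /subcomplex ne.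
have [->|ne] := eqVneq e e0; first by rewrite v0 Se0 c eqxx.
apply/implyP => ve; have := h e.
by rewrite vis_subcomplex ve /S' /subcomplex /= ne.
Qed.

(* [Sl] is meant to be the part of [S] below the size of [e0]: dropping the other
   constraints makes its second moment a count of smaller edges only. *)
Lemma edge_error (Sl : sedge r n -> option (Col H)) : (forall Z : Phi Om (n + L), forall t : 'I_N,
     matches S' (reindex_phi (mix NnL e0 t) Z) ->
     matches Sl (reindex_phi (mix NnL e0 t) Z)) ->
  (cprob P S - dens P H x0 * cprob P S') ^+ 2 <=
  dev x0 * Ephi P (fun Z => copies R NnL e0 Sl Z ^+ 2).
Proof.
move=> S'Sl.
have [sx _] := real0; set d := dens P H x0; set c := col H x0.
have N0' : (N%:R : R) != 0 by rewrite pnatr_eq0 -lt0n.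
pose f (phi : Phi Om n) : R := (col H (phimap phi e0) == c)%:R.
pose G (u : Phi Om L * Phi Om n) : R := copies R NnL e0 S' (cat_phi u.2 u.1).
pose w (u : Phi Om L * Phi Om n) : R := pweight P u.1 * pweight P u.2.
pose a (u : Phi Om L * Phi Om n) : R := (frame_rel H (supp e0) x0 (phimap u.2 e0))%:R *
   (refined_dens (supp e0) u.1 c (phimap u.2 e0) - d).
have w0 u : 0 <= w u by rewrite mulr_ge0 ?pweight_ge0.
have GN (phi : Phi Om n) Y : G (Y, phi) != 0 -> frame_rel H (supp e0) x0 (phimap phi e0).
  apply: contraNT => nf; rewrite /G /copies big1 ?mulr0 // => t _ /=.
  case m: (matches _ _) => //; have := matches_frame m.
  by rewrite phimap_mix_base (negPf nf).
have pairE (F : Phi Om n -> Phi Om L -> R) :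
    Ephi P (fun phi => Ephi P (F phi)) = \sum_u w u * F u.2 u.1.
  rewrite /Ephi; under eq_bigr do rewrite mulr_sumr.
  rewrite exchange_big pair_big /=; apply: eq_bigr => -[Y phi] _ /=.
  by rewrite /w /= mulrCA mulrA.
have -> : cprob P S - d * cprob P S' = \sum_u w u * (a u * G u).
  set X := _ - _.
  have step1 : X = Ephi P (fun phi => (f phi - d) * (matches S' phi)%:R).
    rewrite /X /cprob -EphiZ -EphiB; apply: eq_Ephi => phi.
    by rewrite matches_split mulrBl -natrM mulnb.
  (* Each copy has the law of a single sample and keeps the image of [e0], so the indicator of [S']
     may be replaced by its average [G] over the copies. *)
  have step2 : X = Ephi P (fun phi => Ephi P (fun Y => (f phi - d) * G (Y, phi))).
    transitivity ((N%:R)^-1 * \sum_(t < N) X).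
      by rewrite sumr_const card_ord -[X *+ N]mulr_natl mulKf.
    under eq_bigr => t _ do rewrite step1 -(Ephi_mix Pprob NnL e0 t).
    rewrite -Ephi_sum -EphiZ Ephi_cat //; apply: eq_Ephi => phi; apply: eq_Ephi => Y.
    rewrite /G /copies /= [RHS]mulrCA; congr (_ * _); rewrite mulr_sumr.
    by apply: eq_bigr => t _; rewrite /f phimap_mix_base.
  rewrite step2 pairE -(pair_big predT predT (fun Y phi => w (Y, phi) * ((f phi - d) * G (Y, phi)))) /=.
  rewrite -(pair_big predT predT (fun Y phi => w (Y, phi) * (a (Y, phi) * G (Y, phi)))) /=.
  apply: eq_bigr => Y _; rewrite /w /=.
  under eq_bigr do rewrite -mulrA; under [RHS]eq_bigr do rewrite -mulrA.
  rewrite -!mulr_sumr; congr (_ * _).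
  (* For fixed [Y] the average [G] is constant on the classes of [kap'], so [f] may be replaced by
     its conditional expectation, the refined density. *)
  pose kap' : rel (Phi Om n) := fun phi phi' => kap (supp e0) Y (phimap phi e0) (phimap phi' e0).
  have kap'E : equivalence_rel kap'.
    by move=> p q s; have [h1 h2] := kapE (supp e0) Y (phimap p e0) (phimap q e0) (phimap s e0).
  have cE phi : cexp (pweight P (m := n)) kap' f phi = refined_dens (supp e0) Y c (phimap phi e0).
    rewrite /cexp /refined_dens /cexp; congr (_ / _).
      rewrite big_mkcond [RHS]big_mkcond /=.
      transitivity (Ephi P (fun phi' : Phi Om n => (kap (supp e0) Y (phimap phi e0) (phimap phi' e0))%:R * f phi')).
        by apply: eq_bigr => phi' _; rewrite /kap'; case: ifP; rewrite ?mul1r ?mul0r ?mulr0.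
      rewrite (Ephi_edge Pprob e0 (fun x => (kap (supp e0) Y (phimap phi e0) x)%:R * (col H x == c)%:R)).
      by apply: eq_bigr => x _; case: ifP; rewrite ?mul1r ?mul0r ?mulr0.
    rewrite big_mkcond [RHS]big_mkcond /=.
    transitivity (Ephi P (fun phi' : Phi Om n => (kap (supp e0) Y (phimap phi e0) (phimap phi' e0))%:R)).
      by apply: eq_bigr => phi' _; rewrite /kap'; case: ifP; rewrite ?mulr1 ?mulr0.
    rewrite (Ephi_edge Pprob e0 (fun x => (kap (supp e0) Y (phimap phi e0) x)%:R)).
    by apply: eq_bigr => x _; case: ifP; rewrite ?mulr1 ?mulr0.
  have Ginv phi phi' : kap' phi phi' -> G (Y, phi) = G (Y, phi').
    move=> kk; rewrite /G /copies; congr (_ * _); apply: eq_bigr => t _ /=.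
    congr (_%:R); congr nat_of_bool; apply: eq_forallb => e.
    rewrite vis_subcomplex /=; case ve: (vis S e) => //=; case ne: (e == e0) => //=.
    by rewrite (col_mix_invariant t kk) ?ne.
  transitivity (\sum_phi pweight P phi * (f phi * G (Y, phi)) - \sum_phi pweight P phi * (d * G (Y, phi))).
    by rewrite -sumrB; apply: eq_bigr => phi _; rewrite -mulrBr mulrBl.
  rewrite -(cexpM (pweight_ge0 Pprob (m := n)) kap'E); last by move=> ? ? _ _; exact: Ginv.
  rewrite -sumrB; apply: eq_bigr => phi _; rewrite -mulrBr -mulrBl cE; congr (_ * _).
  (* Where [G] does not vanish, the image of [e0] has the frame colours of [x0]; this localises the
     deviation to one frame class. *)
  have [->|/GN fr] := eqVneq (G (Y, phi)) 0; first by rewrite !mulr0.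
  by rewrite /a /= fr mul1r.
have b2 : \sum_u w u * G u ^+ 2 <= Ephi P (fun Z => copies R NnL e0 Sl Z ^+ 2).
  rewrite Ephi_cat // pairE; apply: ler_sum => -[Y phi] _ /=.
  rewrite ler_wpM2l // lerXn2r ?nnegrE ?mulr_ge0 ?invr_ge0 ?ler0n ?sumr_ge0 //.
  rewrite /G /copies ler_wpM2l ?invr_ge0 ?ler0n //; apply: ler_sum => t _.
  rewrite ler_nat; have := @S'Sl (cat_phi phi Y) t.
  by case: (matches S' _) => //= -> //.
have a2 : \sum_u w u * a u ^+ 2 = dev x0.
  rewrite /dev /Ephi -(pair_big predT predT (fun Y phi => w (Y, phi) * a (Y, phi) ^+ 2)) /=.
  apply: eq_bigr => Y _; rewrite sx -Ephi_edge // /Ephi mulr_sumr.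
  apply: eq_bigr => phi _; rewrite /w /a /= exprMn -mulrA; congr (_ * (_ * (_ * _))).
  by case: (frame_rel _ _ _ _); rewrite ?expr1n ?expr0n.
apply: le_trans (cauchy_schwarz w0 a G) _; rewrite a2.
by rewrite ler_wpM2l ?dev_ge0.
Qed.

End OneEdge.
End Deviation.

Lemma prodr_ge_exp (R : realFieldType) (I : finType) (p : pred I) (F : I -> R)
    (q : R) (D : nat) :
  0 <= q -> q <= 1 -> (#|I| <= D)%N -> (forall i, p i -> q <= F i) ->
  q ^+ D <= \prod_(i | p i) F i.
Proof.
move=> q0 q1 ID qF; apply: (@le_trans _ _ (\prod_(i | p i) q)).
  by rewrite prodr_const; apply: ler_wiXn2l => //; apply: leq_trans (max_card _) ID.
by apply: ler_prod => i pi; rewrite q0 qF.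
Qed.

Lemma card_sedge r n : #|sedge r n| = (n.+1 ^ r)%N.
Proof.
rewrite /sedge /gedge card_dep_ffun foldrE big_map big_enum /=.
by under eq_bigr do rewrite card_option card_ord; rewrite prod_nat_const cardT size_enum_ord.
Qed.

(** Origin of [dev_bound]: [9 ^ D + 1] compares the second moment times [fm] with [Al ^ 2], the 1
    coming from the diagonal term by [q <= Al] and [fm <= 1]; [9 ^ D * t ^ (2 * D)] is the squared
    loss from [Al] to [Am]; the remaining [t ^ 2] buys the relative accuracy [1 / t]. *)
Lemma relative_error (R : realFieldType) (D : nat) (t X v Al A2 fm Am q : R) :
  0 < t -> 0 <= v -> 0 <= Al -> 0 <= A2 -> 0 <= Am -> 0 <= q -> 0 <= fm ->
  X ^+ 2 <= v * (q * Al + A2) ->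
  (9 ^+ D + 1) * 9 ^+ D * t ^+ (2 * D + 2) * v <= fm ->
  A2 * fm <= 9 ^+ D * Al ^+ 2 -> fm <= 1 -> q <= Al ->
  Al <= 3 ^+ D * t ^+ D * Am ->
  t * `|X| <= Am.
Proof.
move=> t0 v0 Al0 A20 Am0 q0 fm0 h1 h2 h3 h4 h5 h6.
rewrite -(ler_pXn2r (n := 2)) ?nnegrE ?mulr_ge0 ?normr_ge0 ?(ltW t0) //.
rewrite exprMn real_normK ?num_real //.
have n0 : (0 : R) < 9 ^+ D by rewrite exprn_gt0 // ltr0n.
set c := (9 ^+ D + 1) * 9 ^+ D * t ^+ (2 * D).
have c0 : 0 < c by rewrite !mulr_gt0 ?exprn_gt0 ?addr_gt0.
have cE : (9 ^+ D + 1) * 9 ^+ D * t ^+ (2 * D + 2) = c * t ^+ 2.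
  by rewrite exprD /c mulrA.
rewrite cE in h2.
suff : c * (t ^+ 2 * X ^+ 2) <= c * Am ^+ 2 by rewrite ler_pM2l.
have s1 : c * (t ^+ 2 * X ^+ 2) <= c * t ^+ 2 * v * (q * Al + A2).
  rewrite mulrA -[leRHS]mulrA ler_wpM2l // mulr_ge0 ?exprn_ge0 ?(ltW c0) ?(ltW t0) //.
have s2 : c * t ^+ 2 * v * (q * Al + A2) <= fm * (q * Al + A2).
  by rewrite ler_wpM2r // addr_ge0 ?mulr_ge0.
have s3 : fm * (q * Al + A2) <= (9 ^+ D + 1) * Al ^+ 2.
  rewrite mulrDr mulrDl mul1r addrC; apply: lerD; first by rewrite mulrC.
  rewrite expr2 -[leRHS]mul1r; apply: ler_pM => //; first by rewrite mulr_ge0.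
  by rewrite ler_wpM2r.
have s4 : Al ^+ 2 <= 9 ^+ D * t ^+ (2 * D) * Am ^+ 2.
  have -> : 9 ^+ D * t ^+ (2 * D) * Am ^+ 2 = (3 ^+ D * t ^+ D * Am) ^+ 2.
    rewrite !exprMn -!exprM mulnC; congr (_ * _ * _).
    by rewrite mulnC exprM; congr (_ ^+ D); ring.
  by rewrite lerXn2r ?nnegrE ?mulr_ge0 ?exprn_ge0 ?ler0n ?(ltW t0).
apply: le_trans s1 _; apply: le_trans s2 _; apply: le_trans s3 _.
by rewrite /c -!mulrA ler_wpM2l ?addr_ge0 ?(ltW n0) // mulrA.
Qed.

(** * Counting by removal of top edges *)

Section Counting.
Variables (R : realType) (r : nat) (Om : 'I_r -> finType)
          (P : forall i : 'I_r, Om i -> R).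
Hypothesis Pprob : isProbs P.
Variables (H : cgraph Om) (L : nat).
Variable kap : forall (I : {set 'I_r}) (Y : Phi Om L), rel (gedge Om).
Hypothesis kapE : forall I Y, equivalence_rel (kap I Y).
Hypothesis kap_ext : forall I Y x y, supp x = I -> supp y = I ->
  kap I Y x y -> ext_rel H #|I| I (img Y) x y.

Variables (Hm D T1 : nat) (T : nat -> nat).
Hypothesis T_gt0 : forall j, (0 < T j)%N.
Hypothesis T_le : forall j, (T j <= T1)%N.
Hypothesis HmD : (Hm.+1 ^ r <= D)%N.
Hypothesis NL : ((2 * T1) ^ D * Hm <= L)%N.

Definition dev_bound j : nat := ((9 ^ D + 1) * 9 ^ D * (2 * T j) ^ (2 * D + 2))%N.

Definition good (x : gedge Om) : bool :=
  ((T #|supp x|)%:R^-1 <= dens P H x) &&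
  ((dev_bound #|supp x|)%:R * dev P H kap x <= fmass P H x).

Definition goods (x : gedge Om) : bool :=
  [forall J : {set 'I_r}, (J != set0) && (J \subset supp x) ==> good (restrict x J)].

Lemma goods_good x : (0 < #|supp x|)%N -> goods x -> good x.
Proof.
by move=> x0 /forallP /(_ (supp x)); rewrite -card_gt0 x0 subxx restrict_supp.
Qed.

Lemma goods_restrict x (J : {set 'I_r}) : J \subset supp x -> goods x -> goods (restrict x J).
Proof.
move=> Jx /forallP h; apply/forallP => K; rewrite supp_restrict (setIidPl Jx).
apply/implyP => /andP[K0 KJ]; rewrite restrict_restrict (setIidPr KJ).
by have := h K; rewrite K0 (subset_trans KJ Jx).
Qed.

Section Complex.
Variable n : nat.
Implicit Types (S : sedge r n -> option (Col H)) (e : sedge r n).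

Definition admissible_complex j S : Prop := forall e, vis S e ->
  (#|supp e| <= j)%N /\ exists2 x, realizes S e x & goods x.


Lemma admissible_sub j j' S (p : pred (sedge r n)) : admissible_complex j S ->
  (forall e, vis S e -> p e -> (#|supp e| <= j')%N) ->
  (forall e (J : {set 'I_r}), vis S e -> p e -> J != set0 -> J \subset supp e -> p (restrict e J)) ->
  admissible_complex j' (subcomplex S p).
Proof.
move=> aS hs pc e; rewrite vis_subcomplex => /andP[ve pe].
have [_ [x rx gx]] := aS e ve; split; first exact: hs.
by exists x => //; apply: realizes_sub => // J J0 Js _; exact: pc.
Qed.

Lemma sdens_dens j S e x : admissible_complex j S -> vis S e ->
  realizes S e x -> sdens P S e = dens P H x.
Proof.
move=> aS ve rx; have e0 : (0 < #|supp e|)%N by case/andP: ve.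
rewrite /sdens (realizes_stcol rx); case: (rx) => sx _.
have [_ [y ry gy]] := aS e ve; have [sy _] := ry.
have tt : tcol H x = tcol H y by rewrite -(realizes_stcol rx) -(realizes_stcol ry).
have gy' : good y by apply: goods_good; rewrite ?sy.
have dy : dens P H y != 0.
  by case/andP: gy' => h _; apply: lt0r_neq0; apply: lt_le_trans h; rewrite invr_gt0 ltr0n.
have fr : frame_rel H (supp x) x y && (col H y == col H x).
  by rewrite -tcol_eqE ?sx ?sy // tt.
rewrite -sx reldens_tcol ?sx //.
suff -> : dens P H x = dens P H y by [].
case/andP: fr => fr /eqP c; rewrite /dens sx sy c; rewrite sx in fr.
exact: (cexp_const _ (frame_rel_equiv _ _) _ fr).
Qed.

Lemma sdens_bounds j S e : admissible_complex j S -> vis S e ->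
  (T #|supp e|)%:R^-1 <= sdens P S e <= 1.
Proof.
move=> aS ve; have [_ [x rx gx]] := aS e ve.
rewrite (sdens_dens aS ve rx) dens_le1 // andbT.
have [sx _] := rx; rewrite -sx.
have : good x by apply: goods_good; rewrite ?sx //; case/andP: ve.
by case/andP.
Qed.

(** In an admissible complex the densities are at least [1 / T], so the tolerance is at most half
    the density and each factor lies between 1/2 and 3/2 of it. *)
Definition approx_count S : Prop := exists2 c : sedge r n -> R,
  forall e, vis S e -> 0 <= c e <= 1 /\
     `|c e - sdens P S e| <= ((2 * T #|supp e|)%:R)^-1
  & cprob P S = \prod_(e | vis S e) c e.

Definition half_prod S : R := \prod_(e | vis S e) (sdens P S e / 2).

Lemma half_prod_gt0 j S : admissible_complex j S -> 0 < half_prod S.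
Proof.
move=> aS; apply: prodr_gt0 => e /(sdens_bounds aS) /andP[h _].
by rewrite divr_gt0 // (lt_le_trans _ h) // invr_gt0 ltr0n.
Qed.

Lemma approx_count_ge j S : admissible_complex j S -> approx_count S ->
  half_prod S <= cprob P S.
Proof.
move=> aS [c hc ->]; apply: ler_prod => e ve.
have [_] := hc e ve; rewrite ler_norml => /andP[h _].
have /andP[h' _] := sdens_bounds aS ve.
have t0 : (0 : R) < (T #|supp e|)%:R^-1 by rewrite invr_gt0 ltr0n.
move: h; rewrite natrM invfM; lra.
Qed.

Lemma approx_count_le j S : admissible_complex j S -> approx_count S ->
  cprob P S <= \prod_(e | vis S e) (3 * (sdens P S e / 2)).
Proof.
move=> aS [c hc ->]; apply: ler_prod => e ve.
have [/andP[-> _]] := hc e ve; rewrite ler_norml => /andP[_ h] /=.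
have /andP[h' _] := sdens_bounds aS ve.
have t0 : (0 : R) < (T #|supp e|)%:R^-1 by rewrite invr_gt0 ltr0n.
move: h; rewrite natrM invfM; lra.
Qed.

Lemma triple_prod_le S : (#|sedge r n| <= D)%N -> 0 <= half_prod S ->
  \prod_(e | vis S e) (3 * (sdens P S e / 2)) <= 3 ^+ D * half_prod S.
Proof.
move=> nD h0; rewrite big_split /= ler_wpM2r // prodr_const ler_eXn2l ?ltr1n //.
exact: leq_trans (max_card _) nD.
Qed.

End Complex.

Lemma sedge_le n : (n <= Hm)%N -> (#|sedge r n| <= D)%N.
Proof. by move=> nH; rewrite card_sedge; apply: leq_trans HmD; case: (posnP r) => [->|r0]; rewrite ?expn0 ?leq_exp2r. Qed.

Section Step.
Variables (n j : nat) (S : sedge r n -> option (Col H)) (e0 : sedge r n).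
Hypothesis nH : (n + n <= Hm)%N.
Hypothesis aS : admissible_complex j S.
Hypothesis v0 : vis S e0.
Hypothesis j0 : #|supp e0| = j.
Hypothesis IH : forall n' (S' : sedge r n' -> option (Col H)),
  (n' <= n + n)%N -> admissible_complex j.-1 S' -> approx_count S'.

Let S1 := subcomplex S (predC1 e0).
Let Sl := subcomplex S (fun e => (#|supp e| < j)%N).
Let Sin := subcomplex Sl (fun e => restrict e0 (supp e) == e).

Let j_gt0 : (0 < j)%N. Proof. by rewrite -j0; case/andP: v0. Qed.

Lemma restrict_top_neq e (J : {set 'I_r}) : vis S e -> e != e0 -> restrict e J != e0.
Proof.
move=> ve; apply: contraNneq => E; apply/eqP/esym; rewrite -E; apply: restrict_id.
have sub : supp e0 \subset supp e by rewrite -E supp_restrict subsetIr.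
have -> : supp e = supp e0.
  by apply/eqP; rewrite eq_sym eqEcard sub j0; have [] := aS ve.
by rewrite -E supp_restrict subsetIl.
Qed.

Lemma admissible_remove : admissible_complex j S1.
Proof.
apply: (admissible_sub aS) => [e ve _|e J ve ne _ _]; first by have [] := aS ve.
exact: restrict_top_neq.
Qed.

Lemma admissible_low : admissible_complex j.-1 Sl.
Proof.
apply: (admissible_sub aS) => [e _ h|e J _ h _ _]; first by rewrite -ltnS (prednK j_gt0).
by apply: leq_ltn_trans h; rewrite supp_restrict subset_leq_card // subsetIr.
Qed.

Lemma admissible_in : admissible_complex j.-1 Sin.
Proof.
apply: (admissible_sub admissible_low) => [e /admissible_low [] //|e J _ /eqP h _ Js].
by rewrite supp_restrict -[X in _ == restrict X _]h restrict_restrict setIC.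
Qed.

Lemma admissible_doubled : admissible_complex j.-1 (doubled Sl e0).
Proof.
move=> E /[dup] vE; rewrite vis_doubled => /andP[ve _].
have [se [x rx gx]] := admissible_low ve; rewrite supp_emap in se.
split => //; exists x => //; apply: stcol_realizes.
  by have [-> _] := rx; rewrite supp_emap.
by rewrite stcol_doubled // (realizes_stcol rx).
Qed.

Lemma sdens_doubled E : vis (doubled Sl e0) E ->
  sdens P (doubled Sl e0) E = sdens P Sl (emap (@unglue r n) E).
Proof. by move=> vE; rewrite /sdens stcol_doubled // supp_emap. Qed.

Lemma sdens_sub (p : pred (sedge r n)) e :
  (forall e (J : {set 'I_r}), vis S e -> p e -> J != set0 -> J \subset supp e -> p (restrict e J)) ->
  vis S e -> p e -> sdens P (subcomplex S p) e = sdens P S e.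
Proof. by move=> pc ve pe; rewrite /sdens stcol_sub // => J *; apply: pc. Qed.

Lemma edge_ratio : approx_count S1 ->
  `|cprob P S / cprob P S1 - sdens P S e0| <= ((2 * T j)%:R)^-1.
Proof.
move=> ac1.
have nn : (n <= n + n)%N by exact: leq_addr.
have nHm : (n <= Hm)%N by exact: leq_trans nH.
have [_ [x0 rx gx]] := aS v0; have [sx hx] := rx.
have x0_gt0 : (0 < #|supp x0|)%N by rewrite sx j0.
have gx0 : good x0 by apply: goods_good.
(* The count of [Sl] is at least a product of at most [D] factors, each at least [1 / (2 * T1)];
   with this many copies the diagonal term is negligible. *)
pose NN := ((2 * T1) ^ D)%N.
have T1_gt0 : (0 < T1)%N by apply: leq_trans (T_le 0).
have NN0 : (0 < NN)%N by rewrite expn_gt0 muln_gt0 T1_gt0.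
have NnL : (NN * n <= L)%N by apply: leq_trans NL; rewrite leq_mul2l nHm orbT.
have hl := half_prod_gt0 admissible_low.
have acl := IH nn admissible_low.
have S1low e : vis S1 e && (#|supp e| < j)%N = vis Sl e.
  rewrite !vis_subcomplex /=; case: eqP => [->|]; rewrite ?andbT // j0 ltnn.
  by rewrite !andbF.
(* Below size [j] the edges of [S1] are those of [Sl]; the others, at most [D] edges of size [j],
   each give a factor of at least [1 / (2 * T j)]. *)
have Aml : half_prod Sl * ((2 * T j)%:R)^-1 ^+ D <= cprob P S1.
  apply: le_trans (approx_count_ge admissible_remove ac1).
  rewrite {2}/half_prod (bigID (fun e => #|supp e| < j)%N) /=.
  apply: ler_pM.
  - exact: ltW.
  - by rewrite exprn_ge0 // invr_ge0 ler0n.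
  - rewrite /half_prod le_eqVlt; apply/orP; left; apply/eqP.
    apply: eq_big => [e|e]; first by rewrite S1low.
    rewrite vis_subcomplex => /andP[ve se]; congr (_ / _).
    transitivity (sdens P S e).
      apply: sdens_sub => // e' J _ h _ _.
      by apply: leq_ltn_trans h; rewrite supp_restrict subset_leq_card // subsetIr.
    apply/esym; apply: sdens_sub => [e' J ve' ne' _ _|//|/=]; first exact: restrict_top_neq.
    by apply: contraTneq se => ->; rewrite j0 ltnn.
  - apply: prodr_ge_exp; rewrite ?invr_ge0 ?ler0n //.
    + by rewrite invf_le1 ?ltr0n ?muln_gt0 ?T_gt0 // ler1n muln_gt0 T_gt0.
    + exact: sedge_le.
    move=> e /andP[v1 nl]; have [sj _] := admissible_remove v1.
    have se : #|supp e| = j by apply/eqP; rewrite eqn_leq sj leqNgt.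
    have /andP[h _] := sdens_bounds admissible_remove v1.
    by rewrite natrM invfM mulrC -se ler_wpM2r // invr_ge0 ler0n.
have t_gt0 : (0 : R) < (2 * T j)%:R by rewrite ltr0n muln_gt0 T_gt0.
have Am0 : 0 < cprob P S1.
  apply: lt_le_trans Aml; by rewrite mulr_gt0 // exprn_gt0 // invr_gt0.
have Ale : cprob P Sl <= 3 ^+ D * half_prod Sl.
  apply: le_trans (approx_count_le admissible_low acl) _.
  by rewrite triple_prod_le ?sedge_le // ltW.
have Al_q : (NN%:R)^-1 <= cprob P Sl.
  apply: le_trans (approx_count_ge admissible_low acl).
  rewrite natrX -exprVn; apply: prodr_ge_exp; rewrite ?invr_ge0 ?ler0n ?sedge_le //.
    by rewrite invf_le1 ?ltr0n ?muln_gt0 ?T1_gt0 // ler1n muln_gt0.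
  move=> e ve; have /andP[h _] := sdens_bounds admissible_low ve.
  rewrite natrM invfM mulrC ler_wpM2r ?invr_ge0 ?ler0n //; apply: le_trans h.
  by rewrite lef_pV2 ?posrE ?ltr0n // ler_nat.
(* If [e0] lands in the frame class of [x0], all constraints strictly inside [e0] hold. *)
have fm_in : fmass P H x0 <= cprob P Sin.
  rewrite /fmass sx.
  rewrite -(Ephi_edge Pprob e0 (fun x => (frame_rel H (supp e0) x0 x)%:R)).
  apply: le_Ephi => // phi; rewrite ler_nat; case: frame_relP => //= h.
  suff -> : matches Sin phi by [].
  apply/forallP => e; apply/implyP; rewrite !vis_subcomplex => /andP[/andP[ve se] /eqP re].
  have sJ : supp e \subset supp e0 by rewrite -re supp_restrict subsetIr.
  have J0 : supp e != set0 by rewrite -card_gt0; case/andP: ve.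
  have Jp : supp e \proper supp e0 by rewrite properEcard sJ j0 se.
  have Se : S e = Some (col H (restrict x0 (supp e))) by rewrite -(hx _ J0 sJ) re.
  by rewrite /Sin /Sl /subcomplex re eqxx se Se (inj_eq Some_inj) (h _ J0 Jp) restrict_phimap re.
have in0 := half_prod_gt0 admissible_in.
(* The edges of [Sin] are those that the doubled complex contains only once; multiplying by its
   count completes the square of the product over [Sl]. The [9 ^ D] is the squared ratio of the
   factors 3/2 and 1/2. *)
have A2f : cprob P (doubled Sl e0) * fmass P H x0 <= 9 ^+ D * cprob P Sl ^+ 2.
  pose F e := 3 * (sdens P Sl e / 2).
  have Fp e : vis Sl e -> 0 <= F e.
    move=> ve; rewrite /F !mulr_ge0 ?invr_ge0 ?ler0n //.
    by have /andP[h _] := sdens_bounds admissible_low ve; apply: le_trans h; rewrite invr_ge0 ler0n.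
  apply: (@le_trans _ _ ((\prod_(e | vis Sl e) F e) ^+ 2)); last first.
    have -> : 9 ^+ D * cprob P Sl ^+ 2 = (3 ^+ D * cprob P Sl) ^+ 2.
      by rewrite exprMn -exprM mulnC exprM; congr (_ ^+ D * _); ring.
    rewrite lerXn2r ?nnegrE ?prodr_ge0 ?mulr_ge0 ?exprn_ge0 ?cprob_ge0 ?ler0n //.
    apply: le_trans (triple_prod_le _ (ltW hl)) _; first exact: sedge_le.
    by rewrite ler_wpM2l ?exprn_ge0 ?ler0n // (approx_count_ge admissible_low).
  have d1 := approx_count_le admissible_doubled (IH (leqnn _) admissible_doubled).
  have d2 := approx_count_le admissible_in (IH nn admissible_in).
  have d1' : cprob P (doubled Sl e0) <= (\prod_(e | vis Sl e) F e) *
     (\prod_(e | vis Sl e && (emap (@glue_fst r n) e != emap (glue_snd e0) e)) F e).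
    apply: le_trans d1 _; rewrite -prod_doubled le_eqVlt; apply/orP; left; apply/eqP.
    by apply: eq_bigr => E vE; rewrite sdens_doubled.
  have d2' : cprob P Sin <= \prod_(e | vis Sl e && (emap (@glue_fst r n) e == emap (glue_snd e0) e)) F e.
    apply: le_trans d2 _; rewrite le_eqVlt; apply/orP; left; apply/eqP.
    apply: eq_big => [e|e]; rewrite vis_subcomplex ?glue_eq_restrict // => /andP[ve re].
    rewrite /F; congr (_ * (_ / _)); rewrite /sdens stcol_sub // => J J0 Js _.
    by rewrite supp_restrict -[X in _ == restrict X _](eqP re) restrict_restrict setIC.
  have -> : (\prod_(e | vis Sl e) F e) ^+ 2 = (\prod_(e | vis Sl e) F e) *
     (\prod_(e | vis Sl e && (emap (@glue_fst r n) e != emap (glue_snd e0) e)) F e) *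
     (\prod_(e | vis Sl e && (emap (@glue_fst r n) e == emap (glue_snd e0) e)) F e).
    rewrite expr2 -mulrA; congr (_ * _).
    by rewrite [LHS](bigID (fun e => emap (@glue_fst r n) e == emap (glue_snd e0) e)) mulrC.
  apply: ler_pM; rewrite ?cprob_ge0 //; last exact: le_trans d2'.
  by apply: sumr_ge0 => x _; rewrite mulr_ge0 ?iweight_ge0.
have top e : vis S e -> (#|supp e| <= #|supp e0|)%N by rewrite j0 => /aS [].
have err : (cprob P S - dens P H x0 * cprob P S1) ^+ 2 <=
    dev P H kap x0 * ((NN%:R)^-1 * cprob P Sl + cprob P (doubled Sl e0)).
  apply: le_trans (edge_error Pprob kapE kap_ext NN0 v0 rx top (NnL := NnL) (Sl := Sl) _) _.
    move=> Z t; apply: matches_subcomplex => e ve se /=.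
    by apply: contraTneq se => ->; rewrite j0 ltnn.
  rewrite ler_wpM2l ?dev_ge0 //; exact: copies_second_moment.
have db : (9 ^+ D + 1) * 9 ^+ D * (2 * T j)%:R ^+ (2 * D + 2) * dev P H kap x0 <= fmass P H x0.
  have /andP[_] := gx0; rewrite sx j0 /dev_bound.
  by rewrite !(natrM, natrD, natrX).
have rel : (2 * T j)%:R * `|cprob P S - dens P H x0 * cprob P S1| <= cprob P S1.
  apply: (relative_error t_gt0 _ _ _ _ _ _ err db A2f _ Al_q);
    rewrite ?dev_ge0 ?cprob_ge0 ?invr_ge0 ?ler0n //.
  - by apply: sumr_ge0 => x _; rewrite mulr_ge0 ?iweight_ge0.
  - exact: le_trans fm_in (cprob_le1 _ _).
  - apply: le_trans Ale _; rewrite -mulrA ler_wpM2l ?exprn_ge0 ?ler0n //.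
    rewrite mulrC -ler_pdivrMr ?exprn_gt0 // -exprVn //.
rewrite (sdens_dens aS v0 rx).
have -> : cprob P S / cprob P S1 - dens P H x0 =
    (cprob P S - dens P H x0 * cprob P S1) / cprob P S1.
  by rewrite mulrBl mulfK // gt_eqF.
rewrite normrM normfV (gtr0_norm Am0) ler_pdivrMr //.
by rewrite ler_pdivlMl.
Qed.

End Step.

(** Induction on the largest size, and inside it on the number of edges of that size. Each decrease
    of [j] may double the vertex set, hence [n * 2 ^ j]. The factor of a removed edge is the ratio
    of the counts with and without it. *)
Theorem counting j n (S : sedge r n -> option (Col H)) :
  (n * 2 ^ j <= Hm)%N -> admissible_complex j S -> approx_count S.
Proof.
elim: j n S => [|j IH] n S nH aS.
  have nv e : ~~ vis S e.
    by apply/negP => /[dup] /aS [+ _]; rewrite leqn0 /vis => /eqP ->.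
  exists (fun=> 1) => [e|]; first by rewrite (negPf (nv e)).
  rewrite big_pred0 => [|e]; last exact: (negPf (nv e)).
  rewrite /cprob -[RHS](Ephi_cst Pprob n 1); apply: eq_Ephi => phi.
  suff -> : matches S phi by [].
  by apply/forallP => e; rewrite (negPf (nv e)).
have nn : (n + n <= Hm)%N.
  apply: leq_trans nH; rewrite expnS mulnA muln2 addnn.
  by rewrite -[X in (X <= _)%N]muln1 leq_mul2l expn_gt0 orbT.
have IH' n' (S' : sedge r n' -> option (Col H)) :
    (n' <= n + n)%N -> admissible_complex j S' -> approx_count S'.
  move=> n'n; apply: IH; apply: leq_trans nH.
  by rewrite expnS mulnA muln2 -addnn leq_mul2r n'n orbT.
have [q] := ubnP #|[set e | vis S e && (#|supp e| == j.+1)]|.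
elim: q S aS => // q IHq S aS hq.
have [/existsP[e0 /andP[v0 /eqP s0]]|/existsPn nex] :=
  boolP [exists e, vis S e && (#|supp e| == j.+1)]; last first.
  apply: IH' (leq_addr _ _) _ => e ve; have [se h] := aS e ve; split => //.
  by move: se (nex e); rewrite leq_eqVlt ve /= => /orP[->|].
have aS1 := admissible_remove aS s0.
have ac1 : approx_count (subcomplex S (predC1 e0)).
  apply: IHq aS1 _; rewrite -ltnS; apply: leq_trans hq; rewrite ltnS.
  apply: proper_card; apply/properP; split.
    apply/subsetP => e; rewrite !inE vis_subcomplex.
    by move=> /andP[/andP[-> _] ->].
  by exists e0; rewrite !inE ?v0 ?s0 ?eqxx // vis_subcomplex /= eqxx andbF.
have ratio := edge_ratio nn aS v0 s0 IH' ac1.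
have pos := lt_le_trans (half_prod_gt0 aS1) (approx_count_ge aS1 ac1).
case: ac1 => c hc cE.
exists (fun e => if e == e0 then cprob P S / cprob P (subcomplex S (predC1 e0)) else c e).
  move=> e ve; case: eqP => [->|/eqP ne].
    rewrite divr_ge0 ?cprob_ge0 // ler_pdivrMr // mul1r s0; split => //.
    apply: le_Ephi => // phi; rewrite ler_nat.
    have /implyP : matches S phi -> matches (subcomplex S (predC1 e0)) phi.
      move=> /forallP h; apply/forallP => e'; rewrite vis_subcomplex; apply/implyP.
      by move=> /andP[ve' ne']; have := h e'; rewrite ve' /subcomplex ne'.
    by case: (matches S phi) => //= ->.
  have := hc e; rewrite vis_subcomplex ve /= => /(_ ne) [h1 h2]; split => //.
  rewrite -(sdens_sub (p := predC1 e0) _ ve) // => e' J ve' ne' _ _.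
  exact: (restrict_top_neq aS s0 J ve' ne').
rewrite (bigD1 e0) //= eqxx; set A1 := cprob P (subcomplex _ _) in pos cE *.
have -> : \prod_(e | vis S e && (e != e0)) (if e == e0 then cprob P S / A1 else c e) = A1.
  rewrite cE; apply: eq_big => [e|e /andP[_ /negPf -> //]].
  by rewrite vis_subcomplex.
by rewrite divfK // gt_eqF.
Qed.

End Counting.

(** * Regularity from a small mass of bad edges *)

Lemma sum_iweight_restrict (R : realType) (r : nat) (Om : 'I_r -> finType)
    (P : forall i : 'I_r, Om i -> R) (I J : {set 'I_r}) (F : gedge Om -> R) :
  isProbs P -> J \subset I ->
  \sum_x iweight P I x * F (restrict x J) = \sum_x iweight P J x * F x.
Proof.
move=> Pprob JI.
pose e : sedge r 1 := [ffun i => if i \in I then Some ord0 else None].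
have se : supp e = I by apply/setP => i; rewrite inE ffunE; case: (i \in I).
have sJ : supp (restrict e J) = J by rewrite supp_restrict se; apply/setIidPl.
rewrite -{1}se -(Ephi_edge Pprob e (fun x => F (restrict x J))).
rewrite -{2}sJ -(Ephi_edge Pprob (restrict e J) F).
by apply: eq_Ephi => phi; rewrite restrict_phimap.
Qed.

Lemma reldens_bounds (R : realType) (r : nat) (Om : 'I_r -> finType)
    (P : forall i : 'I_r, Om i -> R) (H : cgraph Om) I (t : tcolT H) :
  isProbs P -> 0 <= reldens P I t <= 1.
Proof.
move=> Pprob; rewrite /reldens; set den := \sum_(e | _ && frame_match e t) _.
set num := \sum_(e | _ && (tcol H e == t)) _.
have num0 : 0 <= num by apply: sumr_ge0 => e _; exact: eweight_ge0.
have le : num <= den.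
  rewrite /num /den [leLHS]big_mkcond [leRHS]big_mkcond; apply: ler_sum => e _ /=.
  case: eqP => //= _; case: eqP => [<-|_]; last by case: ifP => // _; exact: eweight_ge0.
  suff -> : frame_match e (tcol H e) by [].
  by apply/forallP => J; rewrite eqxx implybT.
case: eqP => [|/eqP n0]; first by rewrite ler01 lexx.
have den0 : 0 < den by rewrite lt_def n0 (le_trans num0 le).
by rewrite divr_ge0 ?(ltW den0) //= ler_pdivrMr // mul1r.
Qed.

Section Regularity.
Variables (R : realType) (r : nat) (Om : 'I_r -> finType)
          (P : forall i : 'I_r, Om i -> R).
Hypothesis Pprob : isProbs P.
Variables (H : cgraph Om) (L : nat).
Variable kap : forall (I : {set 'I_r}) (Y : Phi Om L), rel (gedge Om).
Hypothesis kapE : forall I Y, equivalence_rel (kap I Y).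
Hypothesis kap_ext : forall I Y x y, supp x = I -> supp y = I ->
  kap I Y x y -> ext_rel H #|I| I (img Y) x y.

Variables (k h Hm D T1 : nat) (T : nat -> nat).
Hypothesis T_gt0 : forall j, (0 < T j)%N.
Hypothesis T_le : forall j, (T j <= T1)%N.
Hypothesis HmD : (Hm.+1 ^ r <= D)%N.
Hypothesis NL : ((2 * T1) ^ D * Hm <= L)%N.
Hypothesis hH : (h * 2 ^ k <= Hm)%N.

Local Notation is_good := (good P H kap D T).
Local Notation all_good := (goods P H kap D T).

Definition good_total (t : tcolT H) (x : gedge Om) : bool :=
  [&& (0 < #|supp x| <= k)%N, tcol H x == t & all_good x].

(** Any good edge with total colour [t] may be picked, since [t] determines its size. The value 1
    makes the allowed interval all of [[0, 1]]. *)
Definition delta (t : tcolT H) : R :=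
  if [pick x | good_total t x] is Some x then ((2 * T #|supp x|)%:R)^-1 else 1.

Lemma delta_ge0 t : 0 <= delta t.
Proof. by rewrite /delta; case: pickP => // x _; rewrite invr_ge0 ler0n. Qed.

Lemma delta_notTC t : ~~ inTC k t -> delta t = 1.
Proof.
rewrite /delta; case: pickP => // x /and3P[sx tx _] /existsP[].
by exists x; rewrite sx.
Qed.

Lemma delta_good x : (0 < #|supp x| <= k)%N -> all_good x ->
  delta (tcol H x) = ((2 * T #|supp x|)%:R)^-1.
Proof.
move=> sx gx; rewrite /delta; case: pickP => [y /and3P[/andP[sy _] /eqP txy _]|/(_ x)].
  by case/andP: sx => sx _; rewrite (tcol_supp sy sx txy).
by rewrite /good_total sx eqxx gx.
Qed.

Section OneComplex.
Variable S : sedge r h -> option (Col H).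
Hypothesis scS : is_scomplex k S.


Lemma good_total_realizes e x : visible k S e -> good_total (stcol S e) x ->
  realizes S e x.
Proof.
move=> /[dup] ve /andP[/andP[e0 ek] Se] /and3P[/andP[x0 xk] /eqP tx gx].
apply: stcol_realizes => //; apply/eqP; rewrite eqEsubset; move/ffunP: tx => tx.
apply/andP; split.
  by have := tx (supp x); rewrite !ffunE subxx -card_gt0 x0 /=; case: ifP.
have := tx (supp e); rewrite !ffunE subxx -card_gt0 e0 /= restrict_supp.
by case: ifP => // _ SN; rewrite -SN in Se.
Qed.

Let p (e : sedge r h) : bool := (#|supp e| <= k)%N && [exists x, good_total (stcol S e) x].
Let Sg := subcomplex S p.

Lemma good_part_closed e (J : {set 'I_r}) :
  vis S e -> p e -> J != set0 -> J \subset supp e -> p (restrict e J).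
Proof.
move=> /andP[e0 Se] /andP[ek /existsP[x gx]] J0 Js.
have ve : visible k S e by rewrite /visible e0 ek.
have rx := good_total_realizes ve gx; have [sx hx] := rx.
have sJ : supp (restrict e J) = J by rewrite supp_restrict; apply/setIidPl.
have sxJ : supp (restrict x J) = J by rewrite supp_restrict sx; apply/setIidPl.
have cJ : (0 < #|J| <= k)%N by rewrite card_gt0 J0 (leq_trans (subset_leq_card Js) ek).
rewrite /p sJ; case/andP: (cJ) => _ -> /=; apply/existsP; exists (restrict x J).
rewrite /good_total sxJ cJ /=; case/and3P: gx => _ _ gx.
rewrite goods_restrict ?sx // andbT; apply/eqP/esym/realizes_stcol.
split; rewrite ?sxJ ?sJ // => K K0 KJ.
by rewrite !restrict_restrict (setIidPr KJ) hx // (subset_trans KJ Js).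
Qed.

Lemma vis_good_part e : vis Sg e -> visible k S e.
Proof.
by rewrite vis_subcomplex => /andP[/andP[e0 Se] /andP[ek _]]; rewrite /visible e0 ek.
Qed.

Lemma admissible_good_part : admissible_complex P kap D T k Sg.
Proof.
move=> e /[dup] /vis_good_part ve; rewrite vis_subcomplex => /andP[v pe].
have /andP[ek /existsP[x gx]] := pe; split => //.
have rx := good_total_realizes ve gx; case/and3P: gx => _ _ gx; exists x => //.
by apply: realizes_sub => // J J0 Js _; exact: good_part_closed.
Qed.

(** Only the good part is counted; the other constraints can only lower the probability. If another
    visible edge [e1] exists, it receives the quotient of the two probabilities, which lies in
    [[0, 1]], and the remaining ones receive 1. *)
Lemma scomplex_approx : approx_prod (visible k S) (prob_embed P k S)
  (fun e => reldens P (supp e) (stcol S e)) (fun e => delta (stcol S e)).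
Proof.
have aS := admissible_good_part.
have ac : approx_count P T Sg := counting Pprob kapE kap_ext T_gt0 T_le HmD NL hH aS.
have pos : 0 < cprob P Sg.
  apply: lt_le_trans (approx_count_ge Pprob T_gt0 aS ac).
  exact: (half_prod_gt0 Pprob T_gt0 aS).
have le : prob_embed P k S <= cprob P Sg.
  apply: le_Ephi => // phi; case: forallP => // h0.
  suff -> : matches Sg phi by [].
  apply/forallP => e; apply/implyP => /[dup] /vis_good_part ve.
  rewrite vis_subcomplex => /andP[_ pe]; rewrite /Sg /subcomplex pe.
  by have := h0 e; rewrite ve.
have ge0 : 0 <= prob_embed P k S by apply: Ephi_ge0 => // phi; case: ifP.
case: ac => c hc cE.
have bad e : visible k S e -> ~~ vis Sg e -> delta (stcol S e) = 1.
  move=> ve; rewrite vis_subcomplex; have /andP[/andP[e0 ek] Se] := ve.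
  rewrite /vis e0 Se /p ek /= => /existsPn nx; rewrite /delta; case: pickP => // x.
  by rewrite (negPf (nx x)).
have goodb e : vis Sg e -> Num.max 0 (reldens P (supp e) (stcol S e) - delta (stcol S e)) <=
     c e <= Num.min 1 (reldens P (supp e) (stcol S e) + delta (stcol S e)).
  move=> vg; have [/andP[c0 c1]] := hc e vg.
  have ve := vis_good_part vg; move: (vg); rewrite vis_subcomplex => /andP[v pe].
  have -> : sdens P Sg e = reldens P (supp e) (stcol S e).
    by rewrite /sdens stcol_sub // => J J0 Js _; exact: good_part_closed.
  have /andP[_ /existsP[x gx]] := pe.
  have rx := good_total_realizes ve gx; case/and3P: gx => sk _ gx.
  rewrite (realizes_stcol rx) delta_good //; case: (rx) => -> _.
  rewrite ler_norml => /andP[h1 h2].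
  rewrite ge_max c0 le_min c1 /=; apply/andP; split; first by move: h1; lra.
  by move: h2; lra.
have badb e y : 0 <= y <= 1 -> visible k S e -> ~~ vis Sg e ->
    Num.max 0 (reldens P (supp e) (stcol S e) - delta (stcol S e)) <=
     y <= Num.min 1 (reldens P (supp e) (stcol S e) + delta (stcol S e)).
  move=> /andP[y0 y1] ve nv; rewrite bad //.
  have /andP[d0 d1] := reldens_bounds (supp e) (stcol S e) Pprob.
  by rewrite ge_max le_min y0 y1 /= andbC; apply/andP; split; lra.
have [e1 /andP[v1 n1]|nob] := pickP (fun e => visible k S e && ~~ vis Sg e); last first.
  have eqv e : visible k S e = vis Sg e.
    apply/idP/idP => [ve|]; last exact: vis_good_part.
    by have := nob e; rewrite ve => /negbFE.
  exists c; split => [e|]; first by rewrite eqv; exact: goodb.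
  rewrite (eq_bigl _ _ eqv) -cE; apply: eq_Ephi => phi.
  have -> : [forall e, visible k S e ==> (Some (col H (phimap phi e)) == S e)] = matches Sg phi.
    apply: eq_forallb => e; rewrite eqv; case vg: (vis Sg e) => //=.
    by move: vg; rewrite vis_subcomplex => /andP[_ pe]; rewrite /Sg /subcomplex pe.
  by case: (matches _ _).
exists (fun e => if vis Sg e then c e else if e == e1 then prob_embed P k S / cprob P Sg else 1).
split => [e ve|].
  case: ifP => [vg|/negbT nv]; first exact: goodb.
  apply: badb => //; case: ifP => _; last by rewrite ler01 lexx.
  by rewrite divr_ge0 ?(ltW pos) //= ler_pdivrMr // mul1r.
rewrite (bigID (vis Sg)) /=.
have -> : \prod_(e | visible k S e && vis Sg e)
   (if vis Sg e then c e else if e == e1 then prob_embed P k S / cprob P Sg else 1) = cprob P Sg.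
  rewrite cE; apply: eq_big => [e|e /andP[_ -> //]].
  by rewrite andbC; case vg: (vis Sg e) => //=; exact: vis_good_part.
rewrite (bigD1 e1) ?v1 //= (negPf n1) eqxx big1 ?mulr1; last first.
  by move=> e /andP[/andP[_ /negPf ->] /negPf ->].
by rewrite mulrC divfK // gt_eqF.
Qed.

End OneComplex.

Definition bad_mass (I : {set 'I_r}) : R := \sum_x iweight P I x * (~~ all_good x)%:R.

Lemma regular_of_bad_mass (E : R) :
  (forall I : {set 'I_r}, (0 < #|I| <= k)%N ->
     bad_mass I + ((2 * T #|I|)%:R)^-1 <= E / #|Cset H I|%:R) ->
  regular P k h H E.
Proof.
move=> hE; exists delta; split; first exact: delta_ge0.
split; first exact: delta_notTC.
split=> [S scS|I cI]; first exact: scomplex_approx.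
apply: le_trans (hE I cI); rewrite sum_iweight.
set q := _^-1; have -> : q = \sum_x iweight P I x * q.
  by rewrite -mulr_suml iweight_sum1 // mul1r.
rewrite /q -big_split; apply: ler_sum => x _ /=; rewrite -mulrDr.
have := iweight_ge0 Pprob I x; rewrite le_eqVlt => /orP[/eqP <-|wx]; first by rewrite !mul0r.
have sx := iweight_gt0 wx; rewrite ler_wpM2l ?(ltW wx) //.
have [gx|nx] := boolP (all_good x); first by rewrite delta_good ?sx // lerDr ler0n.
apply: (@le_trans _ _ 1); last by rewrite lerDl invr_ge0 ler0n.
rewrite /delta; case: pickP => // y _.
by rewrite invf_le1 ?ltr0n ?muln_gt0 ?T_gt0 // ler1n muln_gt0 T_gt0.
Qed.

(** Union bound over subedges: the restriction of a random index-[I] edge to [J] is a random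
    index-[J] edge. *)
Lemma bad_mass_union (I : {set 'I_r}) :
  bad_mass I <= \sum_(J : {set 'I_r} | (J != set0) && (J \subset I))
                   \sum_x iweight P J x * (~~ is_good x)%:R.
Proof.
apply: (@le_trans _ _ (\sum_(J : {set 'I_r} | (J != set0) && (J \subset I))
    \sum_x iweight P I x * (~~ is_good (restrict x J))%:R)); last first.
  apply: ler_sum => J /andP[_ JI].
  by rewrite (sum_iweight_restrict (fun x => (~~ is_good x)%:R) Pprob JI).
rewrite exchange_big /=; apply: ler_sum => x _.
have := iweight_ge0 Pprob I x; rewrite le_eqVlt => /orP[/eqP <-|wx].
  by rewrite mul0r big1 // => J _; rewrite mul0r.
have sx := iweight_gt0 wx; rewrite -mulr_sumr ler_wpM2l ?(ltW wx) //.
have [_|] := boolP (all_good x); first by apply: sumr_ge0 => J _; rewrite ler0n.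
rewrite negb_forall => /existsP[J]; rewrite negb_imply sx => /andP[JJ nJ].
by rewrite (bigD1 J) //= nJ lerDl sumr_ge0 // => K _; rewrite ler0n.
Qed.

Definition energy_gap (I : {set 'I_r}) : R :=
  Ephi P (fun Y => energy (iweight P I) (col H) (kap I Y)) -
  energy (iweight P I) (col H) (frame_rel H I).

(** The quotient is the mean, over the frame class, of the squared deviation for the colour of [x].
    Replacing this colour by the sum over all colours and averaging over the classes leaves a
    difference of energies, by Pythagoras. *)
Lemma dev_mass (I : {set 'I_r}) :
  \sum_x iweight P I x * (dev P H kap x / fmass P H x) <= energy_gap I.
Proof.
pose w := iweight P I; have w0 := iweight_ge0 Pprob I.
have frE := frame_rel_equiv H I.
pose g Y c y : R := (cexp w (kap I Y) (fun z => (col H z == c)%:R) y -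
            cexp w (frame_rel H I) (fun z => (col H z == c)%:R) y) ^+ 2.
have g0 Y c y : 0 <= g Y c y by exact: sqr_ge0.
have -> : energy_gap I = Ephi P (fun Y : Phi Om L => \sum_(c : Col H) \sum_x w x * g Y c x).
  rewrite /energy_gap -(Ephi_cst Pprob L (energy _ _ (frame_rel H I))) -EphiB.
  apply: eq_Ephi => Y; rewrite energy_diff // => x y wx wy kxy.
  apply: (@ext_rel_frame _ _ _ #|I| _ (img Y)) => //.
  exact: kap_ext (iweight_gt0 wx) (iweight_gt0 wy) kxy.
have -> : Ephi P (fun Y : Phi Om L => \sum_(c : Col H) \sum_x w x * g Y c x) =
   \sum_x w x * Ephi P (fun Y : Phi Om L => \sum_(c : Col H) cexp w (frame_rel H I) (g Y c) x).
  under [RHS]eq_bigr do rewrite -EphiZ.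
  rewrite -Ephi_sum; apply: eq_Ephi => Y.
  under [RHS]eq_bigr do rewrite mulr_sumr.
  rewrite [RHS]exchange_big; apply: eq_bigr => c _ /=.
  by rewrite (sum_cexp w0 frE).
apply: ler_sum => x _; rewrite /w.
have := w0 x; rewrite le_eqVlt => /orP[/eqP <-|wx]; first by rewrite !mul0r.
have sx := iweight_gt0 wx; rewrite ler_wpM2l ?(ltW wx) //.
rewrite mulrC /dev -EphiZ; apply: le_Ephi => // Y.
apply: (@le_trans _ _ (cexp w (frame_rel H I) (g Y (col H x)) x)); last first.
  rewrite (bigD1 (col H x)) //= lerDl sumr_ge0 // => c _.
  by apply: (cexp_ge0 w0) => y; exact: g0.
rewrite /cexp /fmass sx mulrC le_eqVlt; apply/orP; left; apply/eqP; congr (_ / _).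
  rewrite [RHS]big_mkcond; apply: eq_bigr => y _.
  case fxy: (frame_rel H I x y); last by rewrite mul0r mulr0.
  rewrite mul1r /g /refined_dens /dens sx; congr (_ * (_ - _) ^+ 2).
  exact: (cexp_const _ frE).
rewrite [RHS]big_mkcond; apply: eq_bigr => y _.
by case: (frame_rel H I x y); rewrite ?mulr1 ?mulr0.
Qed.

(** Low density is handled by [low_density_mass], large deviation by Markov's inequality for
    [dev / fmass]. *)
Lemma not_good_mass (I : {set 'I_r}) :
  (forall x, supp x = I -> col H x \in Cset H I) ->
  \sum_x iweight P I x * (~~ is_good x)%:R <=
  (T #|I|)%:R^-1 * #|Cset H I|%:R + (dev_bound D T #|I|)%:R * energy_gap I.
Proof.
move=> hC; have w0 := iweight_ge0 Pprob I.
apply: (@le_trans _ _ (\sum_x iweight P I x *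
    (cexp (iweight P I) (frame_rel H I) (fun y => (col H y == col H x)%:R) x < (T #|I|)%:R^-1)%R%:R
   + (dev_bound D T #|I|)%:R * \sum_x iweight P I x * (dev P H kap x / fmass P H x))); last first.
  apply: lerD; last by rewrite ler_wpM2l ?ler0n ?dev_mass.
  apply: (low_density_mass w0 (frame_rel_equiv H I)).
  - by rewrite invr_ge0 ler0n.
  - exact: iweight_sum1.
  - by move=> x /iweight_gt0 /hC.
rewrite mulr_sumr -big_split; apply: ler_sum => x _ /=.
have := w0 x; rewrite le_eqVlt => /orP[/eqP <-|wx]; first by rewrite !(mul0r, mulr0) addr0.
have sx := iweight_gt0 wx; rewrite [X in _ + X]mulrCA -mulrDr ler_wpM2l ?(ltW wx) //.
have fm0 : 0 < fmass P H x.
  apply: lt_le_trans wx _; rewrite /fmass sx (bigD1 x) //=.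
  rewrite (rel_refl (frame_rel_equiv H I)) mulr1 lerDl sumr_ge0 // => y _.
  by rewrite mulr_ge0 ?w0.
have q0 : 0 <= dev P H kap x / fmass P H x by rewrite divr_ge0 ?dev_ge0 ?(ltW fm0).
rewrite /good sx /dens sx; case: leP => [_|_] /=; last first.
  by rewrite lerDl mulr_ge0 ?ler0n.
rewrite add0r; case: (leP _ (fmass P H x)) => [_|lt] /=.
  by apply: mulr_ge0 => //; exact: ler0n.
by rewrite mulrA ler_pdivlMr // mul1r ltW.
Qed.

Variable a : nat -> nat.
Hypothesis a_anti : forall i j, (0 < i <= j)%N -> (j <= k)%N -> (a j <= a i)%N.
Hypothesis Ca : forall I : {set 'I_r}, (0 < #|I| <= k)%N -> (#|Cset H I| <= a #|I|)%N.
Hypothesis colC : forall x, (0 < #|supp x| <= k)%N -> col H x \in Cset H (supp x).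

Lemma energy_gap_ge0 I : 0 <= energy_gap I.
Proof.
apply: le_trans (dev_mass I); apply: sumr_ge0 => x _.
rewrite mulr_ge0 ?iweight_ge0 // divr_ge0 ?dev_ge0 //.
by apply: sumr_ge0 => y _; rewrite mulr_ge0 ?iweight_ge0.
Qed.

(** A bad subedge of index [J] is charged [#|Cset H I|] for an [I] containing [J]. As [a] decreases
    with the size, this is at most [a #|J|], so the charge depends only on the size of the bad edge
    itself. *)
Lemma reg_le (e0 : R) :
  (forall j, (a j)%:R * ((2 * T j)%:R)^-1 <= e0) ->
  reg P k h H <= e0 + \sum_(J : {set 'I_r} | (0 < #|J| <= k)%N)
     (a #|J|)%:R * ((T #|J|)%:R^-1 * (a #|J|)%:R + (dev_bound D T #|J|)%:R * energy_gap J).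
Proof.
move=> he0.
have t0 (J : {set 'I_r}) : 0 <= (a #|J|)%:R * ((T #|J|)%:R^-1 * (a #|J|)%:R + (dev_bound D T #|J|)%:R * energy_gap J).
  by rewrite mulr_ge0 ?addr_ge0 ?mulr_ge0 ?invr_ge0 ?ler0n ?energy_gap_ge0.
have e00 : 0 <= e0 by apply: le_trans (he0 0%N); rewrite mulr_ge0 ?invr_ge0 ?ler0n.
rewrite /reg; apply: ge_inf.
  by exists 0 => e /= [].
split; first by rewrite addr_ge0 ?sumr_ge0.
apply: regular_of_bad_mass => I cI.
(* An index-[I] edge exists because the law has total mass 1; with no colours the required bound
   would degenerate to 0. *)
have C0 : (0 < #|Cset H I|)%N.
  case: (pickP (fun x : gedge Om => supp x == I)) => [x /eqP sx|no].
    by rewrite card_gt0; apply/set0Pn; exists (col H x); rewrite -sx colC ?sx.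
  have := iweight_sum1 Pprob I; rewrite big1 => [/esym/eqP|x _]; first by rewrite oner_eq0.
  by rewrite /iweight (no x).
rewrite ler_pdivlMr ?ltr0n // mulrDl addrC; apply: lerD.
  apply: le_trans (he0 #|I|); rewrite mulrC ler_wpM2r ?invr_ge0 ?ler0n // ler_nat.
  exact: Ca.
apply: (@le_trans _ _ ((\sum_(J : {set 'I_r} | (J != set0) && (J \subset I))
                   \sum_x iweight P J x * (~~ is_good x)%:R) * #|Cset H I|%:R)).
  by rewrite ler_wpM2r ?ler0n ?bad_mass_union.
rewrite mulr_suml [leLHS]big_mkcond [leRHS]big_mkcond; apply: ler_sum => J _ /=.
case: ifP => [/andP[J0 JI]|_]; last by case: ifP.
have cJ : (0 < #|J| <= #|I|)%N by rewrite card_gt0 J0 subset_leq_card.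
have /andP[J1 JIc] := cJ; have /andP[_ Ik] := cI.
have cJk : (0 < #|J| <= k)%N by rewrite J1 (leq_trans JIc Ik).
rewrite cJk mulrC; apply: ler_pM; rewrite ?ler0n //.
- by apply: sumr_ge0 => x _; rewrite mulr_ge0 ?iweight_ge0.
- by rewrite ler_nat; apply: leq_trans (Ca cI) _; exact: a_anti.
apply: le_trans (not_good_mass _) _ => [x sx|]; first by rewrite -sx colC ?sx.
by rewrite lerD2r ler_wpM2l ?invr_ge0 ?ler0n // ler_nat Ca.
Qed.

End Regularity.

(** * Sample sizes and induction over the levels *)

Section SampleSizes.
Local Open Scope nat_scope.
Variables (r k h p : nat).

Definition hmax := h * 2 ^ k.
Definition emax := hmax.+1 ^ r.
(* All thresholds are functions of an upper bound [a] on the number of colours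
   of the current graph: [1 / thr a] is the smallest admitted relative density
   and [1 / devb a] the largest admitted mean square deviation. *)
Definition thr (a : nat) := 4 * 2 ^ r * p * a ^ 2.
Definition devb (a : nat) := (9 ^ emax + 1) * 9 ^ emax * (2 * thr a) ^ (2 * emax + 2).
Definition fresh_size (a : nat) := (2 * thr a) ^ emax * hmax.
Definition gap_weight (a : nat) := a * devb a.
(** The telescoped energy is at most [2 ^ r]; weighted by [gap_weight a] and averaged over the
    rounds it costs [1 / (4 * p * k)] per level. *)
Definition rounds (a : nat) := 4 * p * k * gap_weight a * 2 ^ r.
Definition ncolors (a m : nat) := a ^ (m.+1 ^ r).

Fixpoint sample_size (f : nat -> nat) (a n : nat) : nat :=
  if n is n'.+1 then sample_size f a n' + f (ncolors a (sample_size f a n')) else 0.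

(* [reserve i a] bounds the number of points that are still to be sampled at
   the levels [i, ..., 1] and for the counting argument. *)
Fixpoint reserve (i a : nat) : nat :=
  if i is i'.+1 then sample_size (reserve i') a (rounds a) else fresh_size a.

Variable a0 : nat.

(** The level is read off from the length: if [ns'] starts with the choice for level [i + 1], then
    [k.-1 - size ns'] is [i], the level of [x], and [reserve i.-1] serves the levels below it. *)
Fixpoint color_bound (ns : seq nat) : nat :=
  if ns is x :: ns' then
    let a := color_bound ns' in
    ncolors a (sample_size (reserve (k.-1 - size ns').-1) a x)
  else a0.

Definition mfun (i : nat) (ns : seq nat) : nat :=
  if ns is x :: ns' then sample_size (reserve i.-1) (color_bound ns') x else 0.

Definition nfun (i : nat) (ns : seq nat) : nat := rounds (color_bound ns).

Hypothesis a0_gt0 : 0 < a0.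

Lemma ncolors_gt0 a m : 0 < a -> 0 < ncolors a m.
Proof. by move=> a_gt0; rewrite expn_gt0 a_gt0. Qed.

Lemma ncolors_ge a m : 0 < a -> a <= ncolors a m.
Proof.
move=> a_gt0; rewrite /ncolors -{1}(expn1 a) leq_pexp2l //.
by rewrite expn_gt0.
Qed.

Lemma leq_exp m n e : m <= n -> m ^ e <= n ^ e.
Proof. by move=> mn; case: (posnP e) => [->|e0]; rewrite ?expn0 ?leq_exp2r. Qed.

Lemma ncolors_mono a a' m m' : 0 < a -> a <= a' -> m <= m' -> ncolors a m <= ncolors a' m'.
Proof.
move=> a_gt0 aa mm; apply: leq_trans (leq_exp _ aa) _.
by rewrite leq_pexp2l ?(leq_trans a_gt0 aa) // leq_exp.
Qed.

Lemma thr_mono a a' : a <= a' -> thr a <= thr a'.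
Proof. by move=> aa; rewrite leq_mul2l leq_exp ?orbT. Qed.

Lemma thr_gt0 a : 0 < p -> 0 < a -> 0 < thr a.
Proof. by move=> p0 a_gt0; rewrite /thr !muln_gt0 !expn_gt0 p0 a_gt0. Qed.

Lemma devb_mono a a' : a <= a' -> devb a <= devb a'.
Proof. by move=> aa; rewrite leq_mul2l leq_exp ?orbT // leq_mul2l thr_mono. Qed.

Lemma fresh_size_mono a a' : a <= a' -> fresh_size a <= fresh_size a'.
Proof. by move=> aa; rewrite leq_mul2r leq_exp ?orbT // leq_mul2l thr_mono. Qed.

Lemma rounds_mono a a' : a <= a' -> rounds a <= rounds a'.
Proof.
by move=> aa; rewrite leq_mul2r leq_mul2l leq_mul ?devb_mono ?orbT.
Qed.

Lemma gap_weight_gt0 a : 0 < p -> 0 < a -> 0 < gap_weight a.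
Proof.
move=> p0 a_gt0; rewrite /gap_weight /devb !muln_gt0 a_gt0 addn1 /= !expn_gt0 /=.
by rewrite muln_gt0 thr_gt0.
Qed.

Lemma rounds_gt0 a : 0 < p -> 0 < k -> 0 < a -> 0 < rounds a.
Proof.
move=> p0 k0 a_gt0; rewrite /rounds; move: (gap_weight_gt0 p0 a_gt0).
by move: (gap_weight a) => w w0; rewrite !muln_gt0 p0 k0 w0 expn_gt0.
Qed.

Lemma sample_size_mono f a a' n n' :
  (forall b b', 0 < b -> b <= b' -> f b <= f b') -> 0 < a -> a <= a' -> n <= n' ->
  sample_size f a n <= sample_size f a' n'.
Proof.
move=> fm a_gt0 aa; elim: n' n => [|n' IH] [|n] //= nn.
by apply: leq_add; [exact: IH | apply: fm; rewrite ?ncolors_gt0 // ncolors_mono ?IH].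
Qed.

Lemma reserve_mono i a a' : 0 < a -> a <= a' -> reserve i a <= reserve i a'.
Proof.
elim: i a a' => [|i IH] a a' a_gt0 aa /=; first exact: fresh_size_mono.
by apply: sample_size_mono => //; exact: rounds_mono.
Qed.

Lemma color_bound_gt0 ns : 0 < color_bound ns.
Proof. by elim: ns => //= x ns IH; exact: ncolors_gt0. Qed.

Lemma color_bound_mono s t : size s = size t -> all2 leq s t ->
  color_bound s <= color_bound t.
Proof.
elim: s t => [|x s IH] [|y t] //= [st] /andP[xy ss].
have le := IH t st ss.
rewrite st; apply: ncolors_mono; rewrite ?color_bound_gt0 //.
by apply: sample_size_mono; rewrite ?color_bound_gt0 // => b b'; exact: reserve_mono.
Qed.

Lemma mfun_incr l i : incr_fun l (mfun i).
Proof.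
move=> [|x s] [|y t] //= <- [st] /andP[xy ss].
apply: sample_size_mono; rewrite ?color_bound_gt0 ?color_bound_mono //.
by move=> b b'; exact: reserve_mono.
Qed.

Lemma nfun_incr l i : incr_fun l (nfun i).
Proof. by move=> s t <- st ss; apply/rounds_mono/color_bound_mono. Qed.

End SampleSizes.

Section Sampling.
Variables (R : realType) (nt : nat -> seq nat -> nat) (k : nat).

Lemma eq_sampleE l ns (F F' : seq nat -> R) :
  (forall ms, size ms = l -> F (ms ++ ns) = F' (ms ++ ns)) ->
  sampleE nt k l ns F = sampleE nt k l ns F'.
Proof.
elim: l ns => [|l IH] ns e /=; first exact: (e [::]).
congr (_ * _); apply: eq_bigr => x _; apply: IH => ms sm.
by rewrite -cat_rcons; apply: e; rewrite size_rcons sm.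
Qed.

Lemma sampleE_Ephi (r : nat) (Om : 'I_r -> finType) (P : forall i : 'I_r, Om i -> R)
    l ns m (F : Phi Om m -> seq nat -> R) :
  sampleE nt k l ns (fun ms => Ephi P (fun phi => F phi ms)) =
  Ephi P (fun phi => sampleE nt k l ns (F phi)).
Proof.
elim: l ns => [|l IH] ns //=; rewrite EphiZ Ephi_sum; congr (_ * _).
by apply: eq_bigr => x _; exact: IH.
Qed.

End Sampling.

(** * Energy bookkeeping through the levels *)

Section Induction.
Variables (R : realType) (r k h p : nat).
Hypotheses (k_gt0 : (0 < k)%N) (p_gt0 : (0 < p)%N).
Variables (Om : 'I_r -> finType) (P : forall i : 'I_r, Om i -> R).
Hypothesis Pprob : isProbs P.

Local Notation D := (emax r k h).
Local Notation thr_ := (thr r p).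
Local Notation devb_ := (devb r k h p).
Local Notation gap_weight_ := (gap_weight r k h p).
Local Notation reserve_ := (reserve r k h p).

(* The graph [lev_graph j] is the one whose edges of size [j] carried their final
   colours first, [lev_bound j] its number of colours, [lev_base j] the points
   sampled at level [j - 1], [lev_acc j] all points sampled since. *)
Record level_data := LevelData {
  lev_graph : nat -> cgraph Om;
  lev_bound : nat -> nat;
  lev_base : nat -> {set point Om};
  lev_acc : nat -> {set point Om} }.

(** The invariant while levels [i, ..., 1] are still to be sampled. Recorded are the sizes above
    [i.+1], whose frames have been recoloured at the level just below them. [lev_frame] bounds the
    energy of the current frames from below; [lev_ext] makes the extension relation of the earlier
    graph a valid refinement for counting. *)
Record compatible (i a : nat) (G : cgraph Om) (d : level_data) : Prop := Compatible {
  bound_gt0 : (0 < a)%N;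
  Cset_le : forall I : {set 'I_r}, (0 < #|I| <= k)%N -> (#|Cset G I| <= a)%N;
  col_Cset : forall x, (0 < #|supp x| <= k)%N -> col G x \in Cset G (supp x);
  lev_bound_le : forall j, (i.+1 < j <= k)%N -> (0 < lev_bound d j <= a)%N;
  lev_bound_anti : forall j j', (i.+1 < j <= j')%N -> (j' <= k)%N ->
    (lev_bound d j' <= lev_bound d j)%N;
  lev_Cset : forall I : {set 'I_r}, (i.+1 < #|I| <= k)%N -> (#|Cset G I| <= lev_bound d #|I|)%N;
  lev_col : forall x y, supp x = supp y -> (i.+1 < #|supp x| <= k)%N ->
    (col G x == col G y) =
    (col (lev_graph d #|supp x|) x == col (lev_graph d #|supp x|) y);
  lev_frame : forall (I : {set 'I_r}) x y, (i.+1 < #|I| <= k)%N -> supp x = I -> supp y = I ->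
    frame_rel G I x y -> ext_rel (lev_graph d #|I|) #|I| I (lev_base d #|I|) x y;
  lev_ext : forall (I : {set 'I_r}) (Q : {set point Om}) x y, (i.+1 < #|I| <= k)%N ->
    supp x = I -> supp y = I -> lev_acc d #|I| \subset Q ->
    ext_rel (lev_graph d #|I|) #|I| I Q x y -> ext_rel G #|I| I Q x y }.

Definition level_gap (d : level_data) (M j : nat) : R :=
  (gap_weight_ (lev_bound d j))%:R *
  (Eimg P M (fun Q => level_energy P (lev_graph d j) j (lev_acc d j :|: Q))
   - level_energy P (lev_graph d j) j (lev_base d j)).

Section Final.
Variables (a : nat) (H : cgraph Om) (d : level_data).
Hypothesis cd : compatible 0 a H d.

Let high (j : nat) := (1 < j <= k)%N.
Let as_ j := if high j then lev_bound d j else a.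

Definition final_rel (I : {set 'I_r}) (Y : Phi Om (fresh_size r k h p a)) : rel (gedge Om) :=
  if high #|I| then ext_rel (lev_graph d #|I|) #|I| I (lev_acc d #|I| :|: img Y)
  else ext_rel H #|I| I (img Y).

Lemma as_bounds j : (0 < as_ j <= a)%N.
Proof.
rewrite /as_; case: ifP => [hj|_]; first exact: (lev_bound_le cd).
by rewrite (bound_gt0 cd) leqnn.
Qed.

Lemma final_rel_equiv I Y : equivalence_rel (final_rel I Y).
Proof. by rewrite /final_rel; case: ifP => _; exact: ext_rel_equiv. Qed.

Lemma final_rel_ext I Y x y : supp x = I -> supp y = I ->
  final_rel I Y x y -> ext_rel H #|I| I (img Y) x y.
Proof.
move=> sx sy; rewrite /final_rel; case: ifP => // hI e.
apply: (ext_rel_subset (subsetUr (lev_acc d #|I|) _)).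
by apply: (lev_ext cd) e => //; exact: subsetUl.
Qed.

(** Such an [I] has no nonempty proper subset, so the refined relation is total and gains no
    energy. *)
Lemma final_gap_small (I : {set 'I_r}) : (#|I| <= 1)%N -> energy_gap P H final_rel I <= 0.
Proof.
move=> I1; rewrite /energy_gap subr_le0 -[leRHS](Ephi_cst Pprob (fresh_size r k h p a)).
apply: le_Ephi => // Y; apply: energy_mono.
- exact: iweight_ge0.
- exact: frame_rel_equiv.
- exact: final_rel_equiv.
by move=> x y _ _ _; rewrite /final_rel /high ltnNge I1 /=; exact: ext_rel_singleton.
Qed.

Lemma final_gap_high (I : {set 'I_r}) : high #|I| ->
  energy_gap P H final_rel I <=
  Eimg P (fresh_size r k h p a) (fun Q => energy (iweight P I) (col (lev_graph d #|I|))
      (ext_rel (lev_graph d #|I|) #|I| I (lev_acc d #|I| :|: Q))) -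
  energy (iweight P I) (col (lev_graph d #|I|))
      (ext_rel (lev_graph d #|I|) #|I| I (lev_base d #|I|)).
Proof.
move=> hI; have w0 := iweight_ge0 Pprob I.
have ce (rho : rel (gedge Om)) : equivalence_rel rho ->
    energy (iweight P I) (col H) rho = energy (iweight P I) (col (lev_graph d #|I|)) rho.
  move=> E; apply: eq_energy => // x y /iweight_gt0 sx /iweight_gt0 sy.
  by have := lev_col cd (x := x) (y := y); rewrite sx sy => -> //.
apply: lerB.
  apply: le_Ephi => // Y; rewrite ce; last exact: final_rel_equiv.
  by rewrite /final_rel hI.
rewrite (ce _ (frame_rel_equiv _ _)); apply: energy_mono => //.
- exact: frame_rel_equiv.
- exact: ext_rel_equiv.
move=> x y /iweight_gt0 sx /iweight_gt0 sy; exact: (lev_frame cd).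
Qed.

Lemma final_reg_le :
  reg P k h H <= 3%:R / (4 * p)%:R +
    \sum_(j < k.+1 | (1 < j)%N) level_gap d (reserve_ 0 a) j.
Proof.
pose T j := thr_ (as_ j).
have a_gt0 := bound_gt0 cd.
have T_gt0 j : (0 < T j)%N by apply: thr_gt0 => //; case/andP: (as_bounds j).
have T_le j : (T j <= thr_ a)%N by apply: thr_mono; case/andP: (as_bounds j).
have NL : ((2 * thr_ a) ^ D * hmax k h <= fresh_size r k h p a)%N by [].
have anti i j : (0 < i <= j)%N -> (j <= k)%N -> (as_ j <= as_ i)%N.
  move=> /andP[i0 ij] jk; have [i1|i1] := leqP i 1.
    by rewrite {2}/as_ /high ltnNge i1 /=; case/andP: (as_bounds j).
  have h1 : high i by rewrite /high i1 (leq_trans ij jk).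
  have h2 : high j by rewrite /high jk (leq_trans i1 ij).
  by rewrite /as_ h1 h2; apply: (lev_bound_anti cd); rewrite ?i1.
have Ca (I : {set 'I_r}) : (0 < #|I| <= k)%N -> (#|Cset H I| <= as_ #|I|)%N.
  by move=> cI; rewrite /as_; case: ifP => hI; [exact: (lev_Cset cd) | exact: (Cset_le cd)].
have pa j : (p * as_ j * (4 * 2 ^ r * as_ j))%N = T j by rewrite /T /thr; lia.
have he0 j : (as_ j)%:R * ((2 * T j)%:R)^-1 <= ((2 * p)%:R)^-1 :> R.
  have /andP[as0 _] := as_bounds j.
  have T2 : (0 : R) < (2 * T j)%:R by rewrite ltr0n; have := T_gt0 j; lia.
  have p2 : (0 : R) < (2 * p)%:R by rewrite ltr0n; lia.
  rewrite ler_pdivrMr // mulrC ler_pdivlMr //.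
  rewrite -natrM ler_nat -pa.
  move: (as_ j) as0 => c c0.
  have -> : (2 * (p * c * (4 * 2 ^ r * c)) = c * (2 * p) * (4 * 2 ^ r * c))%N by ring.
  by rewrite leq_pmulr // !muln_gt0 expn_gt0 c0.
have := reg_le Pprob final_rel_equiv final_rel_ext T_gt0 T_le (leqnn _) NL (leqnn _)
   anti Ca (col_Cset cd) he0.
move=> /le_trans; apply.
(* The first share pays for the tolerances [1 / (2 * T)], the second for the low densities over at
   most [2 ^ r] index sets; the latter dictates the constant in [thr]. *)
have -> : 3%:R / (4 * p)%:R = ((2 * p)%:R)^-1 + ((4 * p)%:R)^-1 :> R.
  by rewrite !natrM; field; rewrite pnatr_eq0 -lt0n.
rewrite -[leRHS]addrA lerD2l.
under eq_bigr do rewrite mulrDr; rewrite big_split /=; apply: lerD.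
  apply: (@le_trans _ _ (\sum_(J : {set 'I_r}) ((4 * 2 ^ r * p)%:R)^-1)).
    rewrite [leLHS]big_mkcond; apply: ler_sum => J _ /=; case: ifP => _; last first.
      by rewrite invr_ge0 ler0n.
    have /andP[as0 _] := as_bounds #|J|.
    rewrite mulrCA ler_pdivrMl ?ltr0n // ler_pdivlMr ?ltr0n ?muln_gt0 ?expn_gt0 ?p_gt0 //.
    rewrite -!natrM ler_nat -pa; lia.
  rewrite sumr_const -cardsT -powersetT card_powerset cardsT card_ord.
  rewrite -[_ *+ _]mulr_natr mulrC ler_pdivrMr ?ltr0n ?muln_gt0 ?expn_gt0 ?p_gt0 //.
  rewrite mulrC ler_pdivlMr ?ltr0n ?muln_gt0 ?p_gt0 // -natrM ler_nat; lia.
pose gap (J : {set 'I_r}) (j : nat) : R := (gap_weight_ (lev_bound d j))%:R *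
  (Eimg P (fresh_size r k h p a) (fun Q => energy (iweight P J) (col (lev_graph d j))
      (ext_rel (lev_graph d j) j J (lev_acc d j :|: Q))) -
  energy (iweight P J) (col (lev_graph d j))
      (ext_rel (lev_graph d j) j J (lev_base d j))).
have -> : \sum_(j < k.+1 | (1 < j)%N) level_gap d (reserve_ 0 a) j =
   \sum_(J : {set 'I_r}) \sum_(j < k.+1 | (1 < j)%N && (#|J| == j)) gap J j.
  under [RHS]eq_bigr do rewrite big_mkcondr.
  rewrite [RHS]exchange_big /=; apply: eq_bigr => j _; rewrite /level_gap /level_energy.
  by rewrite /Eimg Ephi_sum -sumrB mulr_sumr big_mkcond.
rewrite [leLHS]big_mkcond; apply: ler_sum => J _ /=.
have [hJ|nhJ] := boolP (high #|J|).
  have /andP[J1 Jk] := hJ; rewrite (ltnW J1) Jk /=.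
  have Jk' : (#|J| < k.+1)%N by rewrite ltnS.
  rewrite (big_pred1 (Ordinal Jk')) => [|j]; last first.
    transitivity (val j == #|J|) => //=.
    by rewrite eq_sym; case: eqP => [->|]; rewrite ?andbF // J1.
  rewrite /gap /= [leLHS]mulrA -natrM.
  have -> : (as_ #|J| * dev_bound D T #|J| = gap_weight_ (lev_bound d #|J|))%N.
    by rewrite /gap_weight /devb /dev_bound /T /as_ hJ.
  by rewrite ler_wpM2l ?ler0n // final_gap_high.
rewrite big_pred0 => [|j]; last first.
  apply: contraNF nhJ => /andP[j1 /eqP Jj]; rewrite /high Jj j1 -ltnS; exact: ltn_ord.
case: ifP => // /andP[J0 Jk].
have J1 : (#|J| <= 1)%N by move: nhJ; rewrite /high Jk andbT -leqNgt.
by do 2!(apply: mulr_ge0_le0; first exact: ler0n); exact: final_gap_small.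
Qed.

End Final.

Definition push_level (i a : nat) (G : cgraph Om) (Q : {set point Om}) (d : level_data) :=
  LevelData (fun j => if j == i.+2 then G else lev_graph d j)
            (fun j => if j == i.+2 then a else lev_bound d j)
            (fun j => if j == i.+2 then Q else lev_base d j)
            (fun j => if j == i.+2 then Q else lev_acc d j :|: Q).

(** Recolouring at level [i.+1] leaves the colour classes of larger edges intact, so earlier bounds
    survive and size [i.+2] is recorded with the bound [a] valid before sampling. For the larger
    sizes the new points only join [lev_acc]. *)
Lemma compatible_push i a G d m (phi : Phi Om m) : (i.+2 <= k)%N ->
  compatible i.+1 a G d ->
  compatible i (ncolors r a m) (regularize phi G i.+1) (push_level i a G (img phi) d).
Proof.
move=> ik [a_gt0 Cle colC lb la lC lc lf le].
have na := ncolors_ge r m a_gt0.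
have split_j j : (i.+1 < j <= k)%N -> j = i.+2 \/ (j != i.+2 /\ (i.+2 < j <= k)%N).
  by move=> /andP[ij jk]; case: (j =P i.+2) => [|ne]; [left | right; split=> //; lia].
split.
- exact: ncolors_gt0.
- move=> I /andP[I0 Ik]; have [Ii|Ii] := leqP #|I| i.+1; last first.
    by rewrite Cset_regularize_large //; apply: leq_trans na; apply: Cle; rewrite I0.
  apply: Cset_regularize_small => // J IJ Jc; apply: Cle.
  by rewrite (leq_trans I0 (subset_leq_card IJ)) (leq_trans Jc ik).
- move=> x /andP[x0 xk]; apply: col_regularize_Cset => e xe ec; apply: colC.
  rewrite (leq_trans x0 (subset_leq_card xe)) (leq_trans ec) //.
  by rewrite geq_max ik xk.
- move=> j /split_j /= [->|[/negPf -> /lb /andP[-> h']]]; first by rewrite eqxx a_gt0.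
  exact: leq_trans h' na.
- move=> j j' /andP[ij jj] j'k /=.
  have [->|[/negPf nj hj]] : j = i.+2 \/ (j != i.+2 /\ (i.+2 < j <= k)%N).
    by apply: split_j; rewrite ij (leq_trans jj j'k).
    rewrite eqxx; case: eqP => // nj'; have /lb /andP[] // : (i.+2 < j' <= k)%N by lia.
  have /negPf -> : j' != i.+2 by lia.
  by rewrite nj; apply: la => //; lia.
- move=> I /[dup] /andP[Ii _] hI0; rewrite Cset_regularize_large //=.
  have [eI|[/negPf nI hI]] := split_j _ hI0; first by rewrite eI eqxx; apply: Cle; rewrite eI ik.
  by rewrite nI lC.
- move=> x y sxy /[dup] /andP[xi _] hx0; rewrite col_regularize_large //=.
  have [ex|[/negPf nx hx]] := split_j _ hx0; first by rewrite ex eqxx.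
  by rewrite nx lc.
- move=> I x y /split_j[eI|[/negPf nI hI]] sx sy /=.
    by rewrite eI eqxx; exact: frame_regularize_ext.
  by rewrite nI => /(frame_regularize_coarse sx sy); exact: lf.
- move=> I Q x y /[dup] hI0 /split_j[eI|[/negPf nI hI]] sx sy /=.
    by rewrite eI eqxx => sQ; apply: ext_rel_regularize.
  rewrite nI subUset => /andP[sa sQ] e.
  apply: (ext_rel_regularize sx sy _ sQ (le _ _ _ _ hI sx sy sa e)).
  by case/andP: hI0.
Qed.

Lemma level_gap_push_high i a G m (phi : Phi Om m) d M j : j != i.+2 ->
  level_gap (push_level i a G (img phi) d) M j =
  (gap_weight_ (lev_bound d j))%:R *
  (Eimg P M (fun Q => level_energy P (lev_graph d j) j ((lev_acc d j :|: img phi) :|: Q))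
   - level_energy P (lev_graph d j) j (lev_base d j)).
Proof. by move=> /negPf nj; rewrite /level_gap /= nj. Qed.

Lemma level_gap_push i a G m (phi : Phi Om m) d M :
  level_gap (push_level i a G (img phi) d) M i.+2 =
  (gap_weight_ a)%:R * (Eimg P M (fun Q => level_energy P G i.+2 (img phi :|: Q))
   - level_energy P G i.+2 (img phi)).
Proof. by rewrite /level_gap /= eqxx. Qed.

(** Averaging over [phi] turns the [m] points just sampled into part of the reserve: together with
    the [M] reserved ones they are [m + M] independent points. *)
Lemma Ephi_gap m M (W : R) (F : {set point Om} -> R) (c : R) (A : {set point Om}) :
  Ephi P (fun phi : Phi Om m => W * (Eimg P M (fun Q => F ((A :|: img phi) :|: Q)) - c)) =
  W * (Eimg P (m + M) (fun Q => F (A :|: Q)) - c).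
Proof.
rewrite EphiZ EphiB Ephi_cst // Eimg_add //; congr (_ * (_ - _)).
apply: eq_Ephi => phi; apply: eq_Eimg => Q; by rewrite setUA.
Qed.

Section Average.
Variable a0 : nat.
Hypothesis a0_gt0 : (0 < a0)%N.
Local Notation cb := (color_bound r k h p a0).
Local Notation mf := (mfun r k h p a0).
Local Notation nf := (nfun r k h p a0).

(** If [x] is drawn at the current level, the larger sizes see [s x] new points and the lower
    reserve, together [s x.+1], which is at most [s N], their previous reserve. The newly recorded
    size contributes the energy between [s x] and [s x.+1], which telescopes over [x]. *)
Lemma average_reg_le i ns G d : size ns = (k.-1 - i)%N -> (i <= k.-1)%N ->
  compatible i (cb ns) G d ->
  sampleE nf k i ns (fun ns' => regE P k h mf ns' i G) <=
   3%:R / (4 * p)%:R + \sum_(j < k.+1 | (i.+1 < j)%N) level_gap d (reserve_ i (cb ns)) j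
   + i%:R * ((4 * p * k)%:R)^-1.
Proof.
elim: i ns G d => [|i IH] ns G d sn ik cd.
  by rewrite /= mul0r addr0; exact: final_reg_le cd.
have a_gt0 := bound_gt0 cd; set a := cb ns in cd a_gt0 *.
rewrite /=; set N := nf _ ns.
have NE : N = rounds r k h p a by [].
have N_gt0 : (0 < N)%N by exact: rounds_gt0.
pose s x := sample_size r (reserve_ i) a x.
have i2k : (i.+2 <= k)%N by lia.
have mE (x : nat) : mf i.+1 (x :: ns) = s x by [].
have cbE (x : nat) : cb (x :: ns) = ncolors r a (s x).
  rewrite /= sn /s; congr (ncolors _ _ (sample_size _ (reserve _ _ _ _ _) _ _)); lia.
pose q : R := ((4 * p * k)%:R)^-1.
pose old : R := \sum_(j < k.+1 | (i.+2 < j)%N) level_gap d (reserve_ i.+1 a) j.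
pose F Q := level_energy P G i.+2 Q.
pose new x : R := (gap_weight_ a)%:R * (Eimg P (s x.+1) F - Eimg P (s x) F).
have step x : (x < N)%N ->
   sampleE nf k i (x :: ns) (fun ns' => Ephi P (fun phi : Phi Om (mf i.+1 (drop i ns')) =>
      regE P k h mf ns' i (regularize phi G i.+1)))
   <= 3%:R / (4 * p)%:R + old + new x + i%:R * q.
  move=> xN.
  rewrite (@eq_sampleE _ _ _ _ _ _ (fun ns' => Ephi P (fun phi : Phi Om (s x) =>
      regE P k h mf ns' i (regularize phi G i.+1)))); last first.
    by move=> ms sm; rewrite drop_size_cat.
  rewrite sampleE_Ephi.
  apply: (@le_trans _ _ (Ephi P (fun phi : Phi Om (s x) => 3%:R / (4 * p)%:R +
     \sum_(j < k.+1 | (i.+1 < j)%N)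
        level_gap (push_level i a G (img phi) d) (reserve_ i (ncolors r a (s x))) j + i%:R * q))).
    apply: le_Ephi => // phi; rewrite -cbE; apply: IH.
    - by rewrite /= sn; lia.
    - by lia.
    - by rewrite cbE; exact: compatible_push.
  rewrite !EphiD !Ephi_cst // lerD2r -addrA lerD2l.
  rewrite Ephi_sum; have i2k' : (i.+2 < k.+1)%N by [].
  rewrite (bigD1 (Ordinal i2k')) //= addrC; apply: lerD.
    rewrite /old [leLHS]big_mkcond [leRHS]big_mkcond; apply: ler_sum => j _ /=.
    have -> : ((i.+1 < j)%N && (j != Ordinal i2k')) = (i.+2 < j)%N.
      by rewrite -val_eqE /=; lia.
    case: ifP => // ij.
    under eq_Ephi do rewrite level_gap_push_high ?gtn_eqF //.
    rewrite (Ephi_gap _ _ _ (level_energy P (lev_graph d j) j)).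
    rewrite /level_gap ler_wpM2l ?ler0n // lerD2r.
    apply: Eimg_mono => // [Q Q' QQ|]; first by apply: level_energy_mono => //; exact: setUS.
    have -> : (s x + reserve_ i (ncolors r a (s x)) = s x.+1)%N by [].
    apply: sample_size_mono => // b b'; exact: reserve_mono.
  under eq_Ephi do rewrite level_gap_push.
  rewrite EphiZ EphiB /new ler_wpM2l ?ler0n // lerD2r.
  have -> : s x.+1 = (s x + reserve_ i (ncolors r a (s x)))%N by [].
  by rewrite Eimg_add.
apply: (@le_trans _ _ ((N%:R)^-1 * \sum_(x < N) (3%:R / (4 * p)%:R + old + new x + i%:R * q))).
  by rewrite ler_wpM2l ?invr_ge0 ?ler0n //; apply: ler_sum => x _; exact: step.
rewrite 2!big_split /= !sumr_const card_ord mulrDr mulrDr.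
have NR : (N%:R : R) != 0 by rewrite pnatr_eq0 -lt0n.
have avg (c : R) : (N%:R)^-1 * (c *+ N) = c by rewrite -[c *+ N]mulr_natl mulKf.
rewrite !avg -addrA lerD2l.
have tel : \sum_(x < N) new x <= (gap_weight_ a)%:R * (2 ^ r)%:R.
  rewrite -mulr_sumr ler_wpM2l ?ler0n //.
  rewrite -(big_mkord predT (fun x => Eimg P (s x.+1) F - Eimg P (s x) F)) telescope_sumr //.
  apply: (@le_trans _ _ (Eimg P (s N) F)).
    by rewrite lerBlDr lerDl; apply: Ephi_ge0 => // phi; exact: level_energy_ge0.
  rewrite -(Ephi_cst Pprob (s N) (2 ^ r)%:R); apply: le_Ephi => // phi.
  exact: level_energy_le.
rewrite -natr1 mulrDl mul1r addrC lerD2l.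
apply: le_trans (_ : (N%:R)^-1 * ((gap_weight_ a)%:R * (2 ^ r)%:R) <= _).
  by rewrite ler_wpM2l ?invr_ge0 ?ler0n.
have pk0 : (0 : R) < (4 * p * k)%:R by rewrite ltr0n !muln_gt0 p_gt0 k_gt0.
rewrite ler_pdivrMl ?ltr0n // ler_pdivlMr // -!natrM ler_nat NE /rounds.
by rewrite mulnC mulnA.
Qed.

End Average.
End Induction.

Theorem mainTheorem3 (R : realType) (r k h : nat) (b : nat -> nat) (eps : R) :
  (1 <= k)%N -> (k <= r)%N -> (1 <= h)%N ->
  (forall i, (1 <= i <= k)%N -> (0 < b i)%N) -> 0 < eps ->
  exists m nt : nat -> seq nat -> nat,
    (forall i, (1 <= i <= k.-1)%N -> incr_fun (k - i) (m i)) /\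
    (forall i, (1 <= i <= k.-1)%N -> incr_fun (k.-1 - i) (nt i)) /\
    (forall i (s : seq nat), (1 <= i <= k.-1)%N -> size s = (k.-1 - i)%N ->
       (0 < nt i s)%N) /\
    forall (Om : 'I_r -> finType) (P : forall i : 'I_r, Om i -> R),
      isProbs P ->
      forall G : cgraph Om, colored_graph k b G ->
        sampleE nt k k.-1 [::] (fun ns => regE P k h m ns k.-1 G) <= eps.
Proof.
move=> k_gt0 _ _ _ eps_gt0.
pose p := Num.bound eps^-1.
have pB : eps^-1 < p%:R by apply: archi_boundP; rewrite invr_ge0 ltW.
have p_gt0 : (0 < p)%N by rewrite -(ltr0n R); apply: lt_trans pB; rewrite invr_gt0.
pose a0 := (\sum_(i < k.+1) b i).+1.
exists (mfun r k h p a0), (nfun r k h p a0).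
split; first by move=> i _; exact: mfun_incr.
split; first by move=> i _; exact: nfun_incr.
split; first by move=> i s _ _; apply: rounds_gt0 => //; exact: color_bound_gt0.
move=> Om P Pprob G cG.
(* Nothing is recorded at the start, as only sizes above [k] would qualify; the entries are
   dummies. *)
pose d := LevelData (fun=> G) (fun=> 0%N) (fun=> set0) (fun=> set0).
have none j : (k.-1.+1 < j <= k)%N = false by lia.
have cd : compatible k k.-1 (color_bound r k h p a0 [::]) G d.
  split=> //=.
  - move=> I cI; have [-> _] := cG I cI; rewrite /a0 ltnW // ltnS.
    have Ik : (#|I| < k.+1)%N by rewrite ltnS; case/andP: cI.
    by rewrite (bigD1 (Ordinal Ik)) //= leq_addr.
  - by move=> x cx; apply: (cG _ cx).2.
  - by move=> j; rewrite none.
  - by move=> I; rewrite none.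
  - by move=> I x y; rewrite none.
have := average_reg_le (h := h) k_gt0 p_gt0 Pprob (a0 := a0) isT (ns := [::]) _ (leqnn _) cd.
rewrite subnn => /(_ erefl) /le_trans; apply.
rewrite big1 => [|j kj]; last first.
  by exfalso; move: kj (ltn_ord j); lia.
have p0 : (0 : R) < p%:R by rewrite ltr0n.
have k0 : (0 : R) < k%:R by rewrite ltr0n.
apply: (@le_trans _ _ (p%:R^-1)); last first.
  by rewrite -[leRHS]invrK lef_pV2 ?posrE ?invr_gt0 // ltW.
have kk : k.-1%:R <= k%:R :> R by rewrite ler_nat leq_pred.
(* The [k.-1] level costs are rounded up to [k] of them, a share of [1 / (4 * p)], which completes
   [3 / (4 * p)] to [1 / p]. *)
have -> : p%:R^-1 = 3%:R / (4 * p)%:R + 0 + k%:R * ((4 * p * k)%:R)^-1 :> R.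
  by rewrite !natrM; field; rewrite !gt_eqF.
by rewrite lerD2l ler_wpM2r ?invr_ge0 ?ler0n.
Qed.
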